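(* Consider the sequences of stochastic decisions $x_n^k$ and of functions $\mathcal{Q}_t^k$ generated by Algorithm 1 (described in the context) to solve the dynamic programming equations defining the recourse functions $\mathcal{Q}_t$. Assume that the process $(\xi_t)$ is interstage independent with $\xi_1$ deterministic and $\xi_t$ having finite support $\{\xi_{t,1},\dots,\xi_{t,M}\}$ for $t=2,\dots,T$. Assume that for $t=1,\dots,T$: (1) $\mathcal{X}_t\subset\mathbb{R}^d$ is nonempty, convex and compact. (2) For every $x_{1:t}$ the function $f_t(x_{1:t},\cdot)$ is measurable, and for every $j=1,\dots,M$ the function $f_t(\cdot,\Psi_{t,j})$ is proper, convex and lower semicontinuous. (3) For every $j=1,\dots,M$, each component of $g_t(x_0,\cdot,\Psi_{t,j})$ is a convex lower semicontinuous function. (4) There exists $\varepsilon>0$ (the same for all $t$) such that for every $j=1,\dots,M$: (4.1) $[\mathcal{X}_1\times\cdots\times\mathcal{X}_{t-1}]^\varepsilon\times\mathcal{X}_t\subset\mathrm{dom}\,f_t(\cdot,\Psi_{t,j})$; (4.2) for every $x_{1:t-1}\in[\mathcal{X}_1\times\cdots\times\mathcal{X}_{t-1}]^\varepsilon$ the set $X_t(x_{0:t-1},\xi_{t,j})$ is nonempty. (5) If $t\ge 2$, for every $j=1,\dots,M$ there exists $\bar x_{t,j}=(\bar x_{t,j,1},\dots,\bar x_{t,j,t})\in\big(\mathcal{X}_1\times\cdots\times\mathcal{X}_{t-1}\times\mathrm{ri}(\mathcal{X}_t)\big)\cap\mathrm{ri}(\{g_t(x_0,\cdot,\Psi_{t,j})\le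 0\})$ such that $\bar x_{t,j,t}\in X_t(x_0,\bar x_{t,j,1},\dots,\bar x_{t,j,t-1},\xi_{t,j})$. Assume finally that the sampling satisfies: for all $t=2,\dots,T$, $j=1,\dots,M$, $k\ge1$, $\mathbb{P}(\xi_t^k=\xi_{t,j})=\Phi_{t,j}>0$ with $\sum_{j=1}^M\Phi_{t,j}=1$, and $\xi_t^k$ is independent of $\sigma(\xi_2^1,\dots,\xi_T^1,\dots,\xi_2^{k-1},\dots,\xi_T^{k-1},\xi_2^k,\dots,\xi_{t-1}^k)$. Then: (i) almost surely, for $t=2,\dots,T+1$, $$\forall n\in\mathtt{Nodes}(t-1),\qquad\lim_{k\to+\infty}\mathcal{Q}_t(x_{[n]}^k)-\mathcal{Q}_t^k(x_{[n]}^k)=0;$$ (ii) almost surely, $\lim_{k\to+\infty}\mathfrak{Q}_1^k(x_0,\xi_1)=\mathcal{Q}_1(x_0)$, and any accumulation point of the sequence $(x_1^k)_{k\in\mathbb{N}^*}$ (where $x_1^k=x_{n_1}^k$ is the first stage decision at iteration $k$) is an optimal solution of the first stage problem $$\inf\{f_1(x_1,\Psi_1)+\mathcal{Q}_2(x_1): x_1\in X_1(x_0,\xi_1)\},$$ whose optimal value is $\mathcal{Q}_1(x_0)$.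
   Context: Notation: for a set $Z\subset\mathbb{R}^N$ and $\varepsilon>0$, $Z^\varepsilon=[Z]^\varepsilon=Z+\varepsilon\mathbb{B}_N$ with $\mathbb{B}_N$ the closed Euclidean unit ball of $\mathbb{R}^N$; $\mathrm{ri}$ is the relative interior; $x_{s:t}=(x_s,\dots,x_t)$ (also viewed as a concatenated vector). For $t=1$ the conditions involving $\mathcal{X}_1\times\cdots\times\mathcal{X}_{t-1}$ and $x_{1:t-1}$ are read with these arguments absent. Data: $T$ is the number of stages, $d$ the dimension of each decision $x_t$, and $x_0$ is given. The functions $f_t(x_{1:t},\Psi_t)$ take values in $\mathbb{R}\cup\{+\infty\}$ and the $g_t(x_{0:t},\Psi_t)$ are vector-valued. $\xi_t$ is the concatenation of the random elements $\Psi_t$, $b_t$, $(A_{t,\tau})_{\tau=0,\dots,t}$ (vectors $\Psi_t,b_t$, matrices $A_{t,\tau}$). Put $\xi_{1,j}=\xi_1$, $\Psi_{1,j}=\Psi_1$; for $t=2,\dots,T$, $\Phi_{t,j}=\mathbb{P}(\xi_t=\xi_{t,j})>0$ and $\xi_{t,j}$ is the concatenation of $\Psi_{t,j},b_{t,j},(A_{t,\tau,j})_\tau$. Feasible sets: $$X_t(x_{0:t-1},\xi_t)=\Big\{x_t\in\mathcal{X}_t: g_t(x_{0:t},\Psi_t)\le 0,\ \sum_{\tau=0}^t A_{t,\tau}x_\tau=b_t\Big\}.$$ For $t=2,\dots,T$, $\rho_t$ is a coherent law invariant risk measure with dual representation $\rho_t(Z(\xi_t))=\sup_{p\in\mathcal{P}_t}\sum_{j=1}^M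 p_j\Phi_{t,j}Z(\xi_{t,j})$, where $\mathcal{P}_t$ is a convex subset of $\{p\in\mathbb{R}^M:p\ge 0,\ \sum_j p_j\Phi_{t,j}=1\}$. Recourse functions: $\mathcal{Q}_{T+1}\equiv 0$ and, for $t=T,\dots,2$, $\mathcal{Q}_t(x_{1:t-1})=\rho_t(\mathfrak{Q}_t(x_{1:t-1},\xi_t))$ with $\mathfrak{Q}_t(x_{1:t-1},\xi_t)=\inf\{f_t(x_{1:t},\Psi_t)+\mathcal{Q}_{t+1}(x_{1:t}): x_t\in X_t(x_{0:t-1},\xi_t)\}$; $\mathcal{Q}_1(x_0)=\mathfrak{Q}_1(x_0,\xi_1)$ is the optimal value of the first stage problem. Scenario tree: the root $n_0$ (stage 0, decision $x_0$) has one child $n_1$ (stage 1, $\xi_{n_1}=\xi_1$); every node of stage $t-1$, $2\le t\le T$, has $M$ children, one for each possible value of $\xi_t$. $\mathtt{Nodes}(t)$ is the set of nodes of stage $t$, $C(n)$ the set of children of $n$, $\mathcal{P}(n)$ the parent of $n$. If node $m$ of stage $t$ corresponds to $\xi_{t,j}$, then $\xi_m=\xi_{t,j}$, $\Psi_m=\Psi_{t,j}$, $b_m=b_{t,j}$, $A_{\tau,m}=A_{t,\tau,j}$, $\Phi_m=\Phi_{t,j}$, and for $p\in\mathcal{P}_t$ we write $p_m=p_j$. For a node $n$ of stage $t$, $x_{[n]}$ is the history of decisions from $n_1$ to $n$ (its $i$-th component is $x_{\mathcal{P}^{t-i}(n)}$, $i=1,\dots,t$). Algorithm 1. Cut functions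 have the form $\mathcal{Q}_t^k(x_{1:t-1})=\max_{0\le\ell\le k}\big(\theta_t^\ell+\langle\beta_t^\ell,x_{1:t-1}-x^\ell_{[n^\ell_{t-1}]}\rangle\big)$. Initialization: $\theta_t^0=-\infty$, $\beta_t^0=0$ (so $\mathcal{Q}_t^0\equiv-\infty$) for $t=2,\dots,T$; $\theta_{T+1}^k=0$, $\beta_{T+1}^k=0$, $\mathcal{Q}_{T+1}^k\equiv 0$ for all $k\ge 0$. For $k\ge1$ let $$\mathfrak{Q}_t^{k-1}(x_{1:t-1},\xi_t)=\inf\{f_t(x_{1:t},\Psi_t)+\mathcal{Q}_{t+1}^{k-1}(x_{1:t}):x_t\in X_t(x_{0:t-1},\xi_t)\}\quad( * )$$ (for $t=1$ this is denoted $\mathfrak{Q}_1^{k-1}(x_0,\xi_1)$). Iteration $k=1,2,\dots$: sample nodes $(n_0^k,\dots,n_T^k)$ with $n_0^k=n_0$, $n_1^k=n_1$, $n_t^k\in C(n_{t-1}^k)$, corresponding to a realization of random variables $(\xi_1^k,\dots,\xi_T^k)$. For $t=1,\dots,T$ and every $n\in\mathtt{Nodes}(t-1)$: for every $m\in C(n)$, let $x_m^k$ be an optimal solution of $( * )$ with $x_{1:t-1}=x_{[n]}^k$, $\xi_t=\xi_m$; and if $t\ge2$ and $n=n_{t-1}^k$, compute for every $m\in C(n)$ a subgradient $\pi_{k,m}$ of $\mathfrak{Q}_t^{k-1}(\cdot,\xi_m)$ at $x_{[n]}^k$ by the formula $$\pi_{k,m}=f'_{t,x_{1:t-1}}(x_{[n]}^k,x_m^k,\Psi_m)+g'_{t,x_{1:t-1}}(x_0,x_{[n]}^k,x_m^k,\Psi_m)\pi_{k,m,1}+[A_{1,m}^\top;\dots;A_{t-1,m}^\top]\pi_{k,m,2}+[\beta_{t+1,1}^0,\dots,\beta_{t+1,1}^{k-1}]\pi_{k,m,3},$$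 where $f'_{t,x_{1:t-1}}$ is a subgradient at $x_{[n]}^k$ of $f_t(\cdot,x_m^k,\Psi_m)$, the columns of $g'_{t,x_{1:t-1}}$ are subgradients at $x_{[n]}^k$ of the components of $g_t(x_0,\cdot,x_m^k,\Psi_m)$, $\beta_{t+1,1}^\ell$ consists of the first $d(t-1)$ components of $\beta_{t+1}^\ell$, and $\pi_{k,m,1},\pi_{k,m,2},\pi_{k,m,3}$ are optimal Lagrange multipliers for, respectively, the constraints $g_t\le0$, the linear equalities, and the cut constraints $z\ge\theta_{t+1}^\ell+\langle\beta_{t+1}^\ell,(x_{[n]}^k,x_t)-x^\ell_{[n_t^\ell]}\rangle$, $0\le\ell\le k-1$, in the reformulation of $( * )$ with objective $f_t+z$. Let $(p_{k,m})_{m\in C(n)}\in\mathcal{P}_t$ attain $\sup_{p\in\mathcal{P}_t}\sum_{m\in C(n)}p_m\Phi_m\mathfrak{Q}_t^{k-1}(x_{[n]}^k,\xi_m)$, and set $$\theta_t^k=\sum_{m\in C(n)}p_{k,m}\Phi_m\mathfrak{Q}_t^{k-1}(x_{[n]}^k,\xi_m),\qquad\beta_t^k=\sum_{m\in C(n)}p_{k,m}\Phi_m\pi_{k,m}.$$ The decisions $x_m^k$ of iteration $k$ are computed from the cuts $\mathcal{Q}_{t+1}^{k-1}$ available at the beginning of iteration $k$, and thus depend only on the samples of iterations $1,\dots,k-1$. Convention: as long as $\mathcal{Q}_{t+1}^{k-1}\equiv-\infty$ (i.e. for $k<T-t+1$), $( * )$ has value $-\infty$, $x_m^k$ is any feasible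 point, $\theta_t^k=-\infty$ and the corresponding cut is $-\infty$. *)

(* Defs.v *)
From HB Require Import structures.
From mathcomp Require Import all_boot all_order all_algebra.
From mathcomp Require Import all_classical all_reals all_analysis.
From mathcomp Require Import measurable_realfun.

Set Implicit Arguments.
Unset Strict Implicit.
Unset Printing Implicit Defensive.

Import Order.TTheory GRing.Theory Num.Theory.
Import numFieldTopology.Exports.

Local Open Scope classical_set_scope.
Local Open Scope ring_scope.

(* Histories x_{1:t} of decisions in R^d are d x t matrices whose columns are
   x_1, ..., x_t; a d x t matrix also stands for the concatenated vector of
   R^(d * t), with the Euclidean structure below. Stages are numbered from 1;
   when a history x_{1:t-1} is involved, the stage is written t = s.+1. *)

Definition inner (R : realType) m n (A B : 'M[R]_(m, n)) : R :=
  \sum_i \sum_j A i j * B i j.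

Definition enorm (R : realType) m n (A : 'M[R]_(m, n)) : R :=
  Num.sqrt (inner A A).

(* [Z]^eps *)
Definition fatten (R : realType) m n (eps : R) (Z : set 'M[R]_(m, n)) :
    set 'M[R]_(m, n) :=
  [set z + eps *: u | z in Z & u in [set u | enorm u <= 1]].

Definition affine_hull (R : realType) m n (Z : set 'M[R]_(m, n)) :
    set 'M[R]_(m, n) :=
  [set x | exists (k : nat) (w : 'I_k -> R) (z : 'I_k -> 'M[R]_(m, n)),
     [/\ forall i, Z (z i), \sum_i w i = 1 & x = \sum_i w i *: z i]].

Definition relint (R : realType) m n (Z : set 'M[R]_(m, n)) :
    set 'M[R]_(m, n) :=
  [set x | Z x /\ exists2 e : R, 0 < e &
     forall y, affine_hull Z y -> enorm (y - x) <= e -> Z y].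

Definition edom (R : realType) (V : Type) (F : V -> \bar R) : set V :=
  [set x | (F x < +oo)%E].

Definition eproper (R : realType) (V : Type) (F : V -> \bar R) : Prop :=
  (forall x, F x != -oo%E) /\ edom F !=set0.

Definition econvex (R : realType) (V : lmodType R) (F : V -> \bar R) : Prop :=
  forall (x y : V) (l : R), 0 <= l <= 1 ->
    (F (l *: x + (1 - l) *: y)%R <= l%:E * F x + (1 - l)%:E * F y)%E.

Definition is_subgradient (R : realType) m n (F : 'M[R]_(m, n) -> \bar R)
    (x pi : 'M[R]_(m, n)) : Prop :=
  F x \is a fin_num /\ forall y, (F x + (inner pi (y - x))%:E <= F y)%E.

(* x_{1:t} = (x_{1:t-1}, x_t) *)
Definition snoc (R : realType) d s (h : 'M[R]_(d, s)) (x : 'cV[R]_d) :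
    'M[R]_(d, s.+1) :=
  \matrix_(i, j) if unlift ord_max j is Some j' then h i j' else x i ord0.

(* xi_t is the triple of Psi_t, b_t and the row block matrix
   [A_{t,0} ... A_{t,t}]. *)
Definition noise (R : realType) (d r q t : nat) :=
  ('cV[R]_r * 'cV[R]_q * 'M[R]_(q, \sum_(tau < t.+1) d))%type.

Record msp (R : realType) := Msp {
  nstages : nat ;                                        (* T *)
  nscen : nat ;                                          (* M *)
  dimx : nat ;                                           (* d *)
  dimPsi : nat -> nat ;
  dimb : nat -> nat ;
  dimg : nat -> nat ;
  x0 : 'cV[R]_dimx ;
  Xset : nat -> set 'cV[R]_dimx ;
  cost : forall t, 'M[R]_(dimx, t) -> 'cV[R]_(dimPsi t) -> \bar R ;  (* f_t *)
  constr : forall t, 'cV[R]_dimx -> 'M[R]_(dimx, t) ->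
    'cV[R]_(dimPsi t) -> 'cV[R]_(dimg t) ;               (* g_t(x_0, x_{1:t}, Psi) *)
  outcome : forall t, 'I_nscen ->
    noise R dimx (dimPsi t) (dimb t) t ;                 (* xi_{t,j} *)
  Phi : nat -> 'I_nscen -> R ;
  ambig : nat -> set 'cV[R]_nscen                        (* the sets P_t *)
}.

Arguments Xset {R} _ _.
Arguments cost {R} _ {t} _ _.
Arguments constr {R} _ {t} _ _ _.
Arguments outcome {R} _ _ _.
Arguments Phi {R} _ _ _.
Arguments ambig {R} _ _.

Definition xi_type (R : realType) (pb : msp R) (t : nat) :=
  noise R (dimx pb) (dimPsi pb t) (dimb pb t) t.

Section Noise.
Context {R : realType} {d r q t : nat}.
Definition noise_Psi (v : noise R d r q t) : 'cV[R]_r := v.1.1.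
Definition noise_b (v : noise R d r q t) : 'cV[R]_q := v.1.2.
Definition noise_A (v : noise R d r q t) (tau : 'I_t.+1) : 'M[R]_(q, d) :=
  submxrow v.2 tau.
End Noise.

Section Problem.
Context {R : realType} (pb : msp R).

(* X_1 x ... x X_s *)
Definition Xprod s : set 'M[R]_(dimx pb, s) :=
  [set h | forall i : 'I_s, Xset pb i.+1 (col i h)].

(* {g_t(x_0, ., Psi) <= 0} *)
Definition glevel t (psi : 'cV[R]_(dimPsi pb t)) : set 'M[R]_(dimx pb, t) :=
  [set h | forall i, constr pb (x0 pb) h psi i ord0 <= 0].

(* sum_{tau=0}^t A_{t,tau} x_tau *)
Definition linmap t (v : xi_type pb t) (h : 'M[R]_(dimx pb, t)) :
    'cV[R]_(dimb pb t) :=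
  noise_A v ord0 *m x0 pb + \sum_(i < t) noise_A v (lift ord0 i) *m col i h.

(* X_t(x_{0:t-1}, xi_t), t = s.+1 *)
Definition feasible s (h : 'M[R]_(dimx pb, s)) (v : xi_type pb s.+1) :
    set 'cV[R]_(dimx pb) :=
  [set x | [/\ Xset pb s.+1 x, glevel (noise_Psi v) (snoc h x)
             & linmap v (snoc h x) = noise_b v]].

(* The stage s.+1 problem in which V stands for the (exact or approximate)
   cost-to-go of the next stage. *)
Definition stage_obj s (V : 'M[R]_(dimx pb, s.+1) -> \bar R)
    (h : 'M[R]_(dimx pb, s)) (v : xi_type pb s.+1) (x : 'cV[R]_(dimx pb)) :
    \bar R :=
  (cost pb (snoc h x) (noise_Psi v) + V (snoc h x))%E.

Definition stage_value s (V : 'M[R]_(dimx pb, s.+1) -> \bar R)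
    (h : 'M[R]_(dimx pb, s)) (v : xi_type pb s.+1) : \bar R :=
  ereal_inf [set stage_obj V h v x | x in feasible h v].

Definition stage_opt s (V : 'M[R]_(dimx pb, s.+1) -> \bar R)
    (h : 'M[R]_(dimx pb, s)) (v : xi_type pb s.+1) (x : 'cV[R]_(dimx pb)) :
    Prop :=
  feasible h v x /\ stage_obj V h v x = stage_value V h v.

(* sum_j p_j Phi_{t,j} Z_j *)
Definition weighted t (p : 'cV[R]_(nscen pb)) (Z : 'I_(nscen pb) -> \bar R) :
    \bar R :=
  (\sum_j (p j ord0 * Phi pb t j)%:E * Z j)%E.

End Problem.

Arguments Xprod {R} pb s _.

(* Backward recursion on the number n of remaining stages: the value is the
   recourse function of stage s.+1, a function of x_{1:s}, when n + s = T. *)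
Fixpoint recourse_rec (R : realType) (pb : msp R) (Omega : Type)
    (xi : forall t, Omega -> xi_type pb t)
    (rho : nat -> (Omega -> \bar R) -> \bar R) (n s : nat) :
    'M[R]_(dimx pb, s) -> \bar R :=
  if n is n'.+1 then
    fun h => rho s.+1
      (fun w => stage_value (recourse_rec xi rho n' (s := s.+1)) h (xi s.+1 w))
  else fun=> 0%E.

(* The recourse function of stage s.+1 (Q_{s+1} in the usual notation), for
   1 <= s <= T *)
Definition recourse (R : realType) (pb : msp R) (Omega : Type)
    (xi : forall t, Omega -> xi_type pb t)
    (rho : nat -> (Omega -> \bar R) -> \bar R) (s : nat) :
    'M[R]_(dimx pb, s) -> \bar R :=
  recourse_rec xi rho (nstages pb - s) (s := s).

(* Node [::] is n_1; Node [:: j_t; ...; j_2] is the stage t node reached through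
   the outcomes j_2, ..., j_t (latest first). *)
Inductive node (M : nat) := Root | Node of seq 'I_M.
Arguments Root {M}.

Definition stage_of M (n : node M) : nat :=
  if n is Node l then (size l).+1 else 0%N.

Definition parent M (n : node M) : node M :=
  if n is Node (_ :: l) then Node l else Root.

(* For n of stage t - 1, the children of n are the child n j, with
   xi_(child n j) = xi_{t,j}. The root has a single child: child Root j does not
   depend on j, in accordance with xi_{1,j} = xi_1. *)
Definition child M (n : node M) (j : 'I_M) : node M :=
  if n is Node l then Node (j :: l) else Node [::].

(* x_[n] for a node n of stage t; column a (counted from 0) is the decision of
   stage a.+1 *)
Definition node_hist (R : realType) d M (x : node M -> 'cV[R]_d) t
    (n : node M) : 'M[R]_(d, t) :=
  \matrix_(i < d, a < t) x (iter (t - a.+1) (@parent M) n) i ord0.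

(* Sampled outcome indices and outputs. The sample xi_t^k is xi_{t,j} with
   j = sample k t; the cut built for the recourse function of stage s.+1 at
   iteration k has coefficients theta k s and beta k s. *)
Record run (R : realType) (pb : msp R) (Omega : Type) := Run {
  sample : nat -> nat -> Omega -> 'I_(nscen pb) ;
  dec : nat -> node (nscen pb) -> Omega -> 'cV[R]_(dimx pb) ;
  theta : nat -> nat -> Omega -> \bar R ;
  beta : forall k s : nat, Omega -> 'M[R]_(dimx pb, s)
}.

Section Algorithm.
Context {R : realType} {pb : msp R} {Omega : Type} (r : run pb Omega).

Definition sampled_xi k t (w : Omega) : xi_type pb t :=
  outcome pb t (sample r k t w).

(* n_t^k *)
Fixpoint sampled_node k t (w : Omega) : node (nscen pb) :=
  if t is t'.+1 then child (sampled_node k t' w) (sample r k t w) else Root.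

(* x_[n]^k for n of stage t *)
Definition run_hist k t (n : node (nscen pb)) (w : Omega) :
    'M[R]_(dimx pb, t) :=
  node_hist (fun m => dec r k m w) t n.

Definition affine_cut l s (w : Omega) (h : 'M[R]_(dimx pb, s)) : \bar R :=
  (theta r l s w +
   (inner (beta r l s w) (h - run_hist l s (sampled_node l s w) w))%:E)%E.

(* The lower approximation, after iteration k, of the recourse function of
   stage s.+1 *)
Definition cut_model k s (w : Omega) (h : 'M[R]_(dimx pb, s)) : \bar R :=
  \big[maxe/-oo%E]_(l < k.+1) affine_cut l w h.

(* Dual function of the problem
     min f + z over x in X_{s+1} and real z,
     s.t. g <= 0, sum_tau A_tau x_tau = b, z >= (cut l) for l < k.
   When theta = -oo, the products 0 * -oo = 0 and c * -oo = -oo (c > 0) force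
   the multiplier of the corresponding (void) constraint to be 0. *)
Definition dual_fun k s (w : Omega) (h : 'M[R]_(dimx pb, s))
    (v : xi_type pb s.+1) (mu1 : 'cV[R]_(dimg pb s.+1))
    (mu2 : 'cV[R]_(dimb pb s.+1)) (mu3 : 'cV[R]_k) : \bar R :=
  ereal_inf [set (cost pb (snoc h x) (noise_Psi v) + z%:E
    + (inner mu1 (constr pb (x0 pb) (snoc h x) (noise_Psi v)))%:E
    + (inner mu2 (linmap v (snoc h x) - noise_b v))%:E
    + \sum_(l < k) (mu3 l ord0)%:E * (affine_cut l w (snoc h x) - z%:E))%E
    | x in Xset pb s.+1 & z in [set: R]].

Definition optimal_multipliers k s (w : Omega) (h : 'M[R]_(dimx pb, s))
    (v : xi_type pb s.+1) (mu1 : 'cV[R]_(dimg pb s.+1))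
    (mu2 : 'cV[R]_(dimb pb s.+1)) (mu3 : 'cV[R]_k) : Prop :=
  [/\ forall i, 0 <= mu1 i ord0, forall l, 0 <= mu3 l ord0 &
      forall (nu1 : 'cV[R]_(dimg pb s.+1)) (nu2 : 'cV[R]_(dimb pb s.+1))
        (nu3 : 'cV[R]_k),
        (forall i, 0 <= nu1 i ord0) -> (forall l, 0 <= nu3 l ord0) ->
        (dual_fun w h v nu1 nu2 nu3 <= dual_fun w h v mu1 mu2 mu3)%E].

(* The formula giving pi_{k,m} from f', g' and the multipliers, at the history
   h = x_[n]^k, with xi_m = v and x_m^k = x *)
Definition pi_formula k s (w : Omega) (h : 'M[R]_(dimx pb, s))
    (v : xi_type pb s.+1) (x : 'cV[R]_(dimx pb)) (pi : 'M[R]_(dimx pb, s)) :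
    Prop :=
  exists (f' : 'M[R]_(dimx pb, s))
         (g' : 'I_(dimg pb s.+1) -> 'M[R]_(dimx pb, s))
         (mu1 : 'cV[R]_(dimg pb s.+1)) (mu2 : 'cV[R]_(dimb pb s.+1))
         (mu3 : 'cV[R]_k),
    [/\ is_subgradient (fun y => cost pb (snoc y x) (noise_Psi v)) h f',
        forall i, is_subgradient (fun y =>
          (constr pb (x0 pb) (snoc y x) (noise_Psi v) i ord0)%:E) h (g' i),
        optimal_multipliers w h v mu1 mu2 mu3 &
        pi = f' + \sum_i mu1 i ord0 *: g' i
           + (\matrix_(a < dimx pb, c < s)
                ((noise_A v (lift ord0 (widen_ord (leqnSn s) c)))^T *m mu2)
                  a ord0)
           + \sum_(l < k) mu3 l ord0 *: col' ord_max (beta r l s.+1 w)].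

(* The value, at node n of stage s, of the stage s.+1 problem with outcome j
   solved at iteration k.+1 *)
Definition trial_value k s (n : node (nscen pb)) (w : Omega)
    (j : 'I_(nscen pb)) : \bar R :=
  stage_value (cut_model k (s := s.+1) w) (run_hist k.+1 s n w)
    (outcome pb s.+1 j).

(* Iterations are k.+1 = 1, 2, ... *)
Record run_spec (w : Omega) : Prop := RunSpec {
  alg_init : forall s, (1 <= s < nstages pb)%N ->
    theta r 0 s w = -oo%E /\ beta r 0 s w = 0 ;
  alg_last : forall k,
    theta r k (nstages pb) w = 0%E /\ beta r k (nstages pb) w = 0 ;
  alg_decision : forall k s (n : node (nscen pb)) j,
    (s < nstages pb)%N -> stage_of n = s ->
    stage_opt (cut_model k (s := s.+1) w) (run_hist k.+1 s n w)
      (outcome pb s.+1 j) (dec r k.+1 (child n j) w) ;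
  alg_cut : forall k s, (1 <= s < nstages pb)%N ->
    let n := sampled_node k.+1 s w in
    let h := run_hist k.+1 s n w in
    exists (p : 'cV[R]_(nscen pb))
           (pi : 'I_(nscen pb) -> 'M[R]_(dimx pb, s)),
      [/\ forall j, (exists y, cut_model k (s := s.+1) w y != -oo%E) ->
            is_subgradient (fun y => stage_value (cut_model k (s := s.+1) w) y
                              (outcome pb s.+1 j)) h (pi j)
            /\ pi_formula k.+1 w h (outcome pb s.+1 j)
                 (dec r k.+1 (child n j) w) (pi j),
          ambig pb s.+1 p
          /\ (forall p', ambig pb s.+1 p' ->
               (weighted s.+1 p' (trial_value k s n w)
                <= weighted s.+1 p (trial_value k s n w))%E),
          theta r k.+1 s w = weighted s.+1 p (trial_value k s n w) &
          beta r k.+1 s w = \sum_j (p j ord0 * Phi pb s.+1 j) *: pi j]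
}.

Definition same_samples k (w w' : Omega) : Prop :=
  forall l t, (1 <= l <= k)%N -> (2 <= t <= nstages pb)%N ->
    sampled_xi l t w = sampled_xi l t w'.

(* The decisions of iteration k are functions of the samples of iterations
   1, ..., k - 1, and the cuts of iteration k of those of iterations 1, ..., k *)
Definition nonanticipative : Prop :=
  (forall k (m : node (nscen pb)) w w',
     (1 <= stage_of m <= nstages pb)%N ->
     same_samples k w w' -> dec r k.+1 m w = dec r k.+1 m w') /\
  (forall k s w w', (1 <= s < nstages pb)%N -> same_samples k.+1 w w' ->
     theta r k.+1 s w = theta r k.+1 s w' /\
     beta r k.+1 s w = beta r k.+1 s w').

End Algorithm.

Section Probability.
Context {disp : measure_display} {Omega : measurableType disp} {R : realType}.
Context (P : probability Omega R).

(* Measurability with respect to the Borel sigma-algebra of V *)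
Definition random_element (V : topologicalType) (X : Omega -> V) : Prop :=
  forall B, <<s @open V >> B -> measurable (X @^-1` B).

(* sigma(X) *)
Definition sigma_of (V : topologicalType) (X : Omega -> V) : set (set Omega) :=
  preimage_set_system setT X <<s @open V >>.

Definition independent_of (V : topologicalType) (X : Omega -> V)
    (G : set (set Omega)) : Prop :=
  forall A B, sigma_of X A -> G B -> P (A `&` B) = (P A * P B)%E.

(* xi_t is independent of sigma(xi_1, ..., xi_{t-1}) *)
Definition interstage_independent (pb : msp R)
    (xi : forall t, Omega -> xi_type pb t) : Prop :=
  forall t, (2 <= t <= nstages pb)%N ->
    independent_of (xi t)
      <<s \bigcup_(tau in [set tau | (1 <= tau < t)%N]) sigma_of (xi tau) >>.

(* sigma(xi_2^1, ..., xi_T^1, ..., xi_2^{k-1}, ..., xi_T^{k-1},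
         xi_2^k, ..., xi_{t-1}^k) *)
Definition sigma_past (pb : msp R) (r : run pb Omega) k t : set (set Omega) :=
  <<s \bigcup_(q in [set q : nat * nat |
          (1 <= q.1 < k)%N /\ (2 <= q.2 <= nstages pb)%N
          \/ q.1 = k /\ (2 <= q.2 < t)%N])
        sigma_of (sampled_xi r q.1 q.2) >>.

(* rho as a coherent law invariant risk measure on the real random variables
   measurable with respect to F; rho also has values on extended random
   variables. *)
Record coherent_law_invariant (F : set (set Omega))
    (rho : (Omega -> \bar R) -> \bar R) : Prop := CoherentLawInvariant {
  rm_fin : forall Z : Omega -> R,
    (forall B, measurable B -> F (Z @^-1` B)) ->
    rho (EFin \o Z) \is a fin_num ;
  rm_monotone : forall Z1 Z2 : Omega -> R,
    (forall B, measurable B -> F (Z1 @^-1` B)) ->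
    (forall B, measurable B -> F (Z2 @^-1` B)) ->
    {ae P, forall w, Z1 w <= Z2 w} ->
    (rho (EFin \o Z1) <= rho (EFin \o Z2))%E ;
  rm_convex : forall (Z1 Z2 : Omega -> R) (l : R),
    (forall B, measurable B -> F (Z1 @^-1` B)) ->
    (forall B, measurable B -> F (Z2 @^-1` B)) -> 0 <= l <= 1 ->
    (rho (fun w => (l * Z1 w + (1 - l) * Z2 w)%:E)
     <= l%:E * rho (EFin \o Z1) + (1 - l)%:E * rho (EFin \o Z2))%E ;
  rm_translation : forall (Z : Omega -> R) (c : R),
    (forall B, measurable B -> F (Z @^-1` B)) ->
    rho (fun w => (Z w + c)%:E) = (rho (EFin \o Z) + c%:E)%E ;
  rm_homogeneous : forall (Z : Omega -> R) (l : R),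
    (forall B, measurable B -> F (Z @^-1` B)) -> 0 <= l ->
    rho (fun w => (l * Z w)%:E) = (l%:E * rho (EFin \o Z))%E ;
  rm_law_invariant : forall Z1 Z2 : Omega -> R,
    (forall B, measurable B -> F (Z1 @^-1` B)) ->
    (forall B, measurable B -> F (Z2 @^-1` B)) ->
    (forall B, measurable B -> P (Z1 @^-1` B) = P (Z2 @^-1` B)) ->
    rho (EFin \o Z1) = rho (EFin \o Z2)
}.

Definition dual_representation (pb : msp R)
    (xi : forall t, Omega -> xi_type pb t)
    (rho : nat -> (Omega -> \bar R) -> \bar R) t : Prop :=
  forall Z : xi_type pb t -> \bar R,
    rho t (fun w => Z (xi t w))
    = ereal_sup [set weighted t p (fun j => Z (outcome pb t j)) |
                  p in ambig pb t].

End Probability.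

(* Main.v *)
Require Import Defs.
From HB Require Import structures.
From mathcomp Require Import all_boot all_order all_algebra.
From mathcomp Require Import all_classical all_reals all_analysis.
From mathcomp Require Import measurable_realfun.
From mathcomp Require Import ring lra zify.

Set Implicit Arguments.
Unset Strict Implicit.
Unset Printing Implicit Defensive.

Import Order.TTheory GRing.Theory Num.Theory.
Import numFieldTopology.Exports.

Local Open Scope classical_set_scope.
Local Open Scope ring_scope.

(** The idea of the proof. For each stage, the models [cut_model] built by the
    algorithm increase from one iteration to the next and stay below the recourse
    function, because a cut averages subgradient inequalities of the stage
    problems with weights that are admissible in the risk measure ([cut_le_dp]).
    What has to be shown is that the gap between the two closes at the decisions
    that the algorithm visits.

    Three facts carry the argument along a single sample path. The slopes of the
    cuts are bounded, since the approximate stage problems are squeezed between a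
    constant and the exact stage problem, which is finite on a neighbourhood of
    the set of feasible histories ([subgradient_bound], [beta_bounded]). Therefore
    the models are equi-Lipschitz and, being increasing and bounded on a compact
    set, converge uniformly there ([cut_uniform_cauchy]); in particular replacing
    a model by the next one costs arbitrarily little in the long run. And at the
    node where a cut is built, the gap is at most the largest gap at the children
    ([sampled_gap]), because the cut is tight for the approximate stage problems
    and their optimal decisions are feasible in the exact ones.

    By backward induction on the stages, starting from the last one where both
    functions vanish, the gap at a node thus tends to zero along the iterations
    that sample this node. To pass to all iterations, call an iteration bad when
    the gap of the current model at the current decision exceeds a given
    tolerance. This depends only on the samples of earlier iterations, while the
    node is sampled with a fixed positive probability, independently of them.
    A conditional form of the Borel-Cantelli lemma
    ([conditional_borel_cantelli]) shows that almost surely, infinitely many bad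
    iterations would include infinitely many that sample the node; these do not
    exist, so bad iterations are finitely many ([gap_vanishes_step],
    [gap_ae_vanishes]).

    The first stage problem is then squeezed between its approximation and that
    approximation plus the gap, which gives the limit of the values. An
    accumulation point of the first stage decisions is optimal because the exact
    objective is lower semicontinuous ([dp_lsc]) and the feasible set is closed
    ([near_infeasible]). *)

(** * Topology and l1 norm of matrices *)

Section MatrixTopology.
Context {R : realType}.

Lemma continuous_mx (T : topologicalType) m n (f : T -> 'M[R]_(m, n)) :
  (forall i j, continuous (fun y => f y i j)) -> continuous f.
Proof.
move=> cf y A [Q yQ sQA]; apply: (@filterS _ _ _ _ _ (sQA : _ `<=` A)).
apply: (@filterS _ _ _ (fun y' => forall ij : 'I_m * 'I_n,
    Q ij.1 ij.2 (f y' ij.1 ij.2))) => [y' + i j|]; first by move=> /(_ (i, j)).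
by apply: filter_forall => -[i j]; apply: cf; exact: yQ.
Qed.

Lemma hausdorff_mx m n : hausdorff_space 'M[R]_(m, n).
Proof.
move=> p q pq; apply/matrixP => i j; apply: Rhausdorff => A B pA qB.
have [N [pN qN]] := pq _ _ (@coord_continuous _ _ _ i j p A pA)
  (@coord_continuous _ _ _ i j q B qB).
by exists (N i j).
Qed.

Lemma hausdorff_prod (T U : topologicalType) :
  hausdorff_space T -> hausdorff_space U -> hausdorff_space (T * U)%type.
Proof.
move=> hT hU [p1 p2] [q1 q2] pq; congr pair.
- apply: hT => A B pA qB.
  have [[x1 x2] [/= ? ?]] := pq _ _ (cvg_fst (pA : nbhs p1 A) : nbhs (p1, p2) _)
    (cvg_fst (qB : nbhs q1 B) : nbhs (q1, q2) _).
  by exists x1.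
- apply: hU => A B pA qB.
  have [[x1 x2] [/= ? ?]] := pq _ _ (cvg_snd (pA : nbhs p2 A) : nbhs (p1, p2) _)
    (cvg_snd (qB : nbhs q2 B) : nbhs (q1, q2) _).
  by exists x2.
Qed.

Lemma snocE d s (h : 'M[R]_(d, s)) x i (j : 'I_s) :
  snoc h x i (lift ord_max j) = h i j.
Proof. by rewrite mxE liftK. Qed.

Lemma snoc_last d s (h : 'M[R]_(d, s)) x i : snoc h x i ord_max = x i ord0.
Proof. by rewrite mxE unlift_none. Qed.

Lemma continuous_snoc d s :
  continuous (fun q : 'cV[R]_d * 'M[R]_(d, s) => snoc q.2 q.1).
Proof.
apply: continuous_mx => i j.
have -> : (fun q : 'cV[R]_d * 'M[R]_(d, s) => snoc q.2 q.1 i j) =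
    (if unlift ord_max j is Some j' then fun q => q.2 i j'
     else fun q => q.1 i ord0).
  by apply/funext => q; rewrite mxE; case: unlift.
case: unlift => [j'|] q.
  apply: (@continuous_comp _ _ _ snd (fun M : 'M[R]_(d, s) => M i j')).
    exact: cvg_snd.
  exact: coord_continuous.
apply: (@continuous_comp _ _ _ fst (fun M : 'cV[R]_d => M i ord0)).
  exact: cvg_fst.
exact: coord_continuous.
Qed.

(** The l1 norm serves both for slopes and for displacements: it bounds [inner]
    without any dimensional constant, and estimates of the entries of a
    subgradient add up to an estimate of its norm. *)
Definition l1 m n (A : 'M[R]_(m, n)) : R := \sum_i \sum_j `|A i j|.

Lemma l1_ge0 m n (A : 'M[R]_(m, n)) : 0 <= l1 A.
Proof. by apply: sumr_ge0 => i _; apply: sumr_ge0. Qed.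

Lemma le_l1 m n (A : 'M[R]_(m, n)) i j : `|A i j| <= l1 A.
Proof.
rewrite /l1 (bigD1 i) //= (bigD1 j) //= -addrA lerDl addr_ge0 ?sumr_ge0 //.
by move=> *; apply: sumr_ge0.
Qed.

Lemma l1N m n (A : 'M[R]_(m, n)) : l1 (- A) = l1 A.
Proof.
by apply: eq_bigr => i _; apply: eq_bigr => j _; rewrite mxE normrN.
Qed.

Lemma l1D m n (A B : 'M[R]_(m, n)) : l1 (A + B) <= l1 A + l1 B.
Proof.
rewrite /l1 -big_split; apply: ler_sum => i _.
by rewrite -big_split; apply: ler_sum => j _; rewrite mxE ler_normD.
Qed.

Lemma l1Z m n a (A : 'M[R]_(m, n)) : l1 (a *: A) = `|a| * l1 A.
Proof.
rewrite /l1 mulr_sumr; apply: eq_bigr => i _; rewrite mulr_sumr.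
by apply: eq_bigr => j _; rewrite mxE normrM.
Qed.

Lemma l1_sum m n (I : Type) (s : seq I) (A : I -> 'M[R]_(m, n)) :
  l1 (\sum_(i <- s) A i) <= \sum_(i <- s) l1 (A i).
Proof.
elim: s => [|i s IH].
  by rewrite !big_nil /l1 big1 // => i _; rewrite big1 // => j _; rewrite mxE normr0.
by rewrite !big_cons (le_trans (l1D _ _)) // lerD2l.
Qed.

Lemma innerBr m n (A B C : 'M[R]_(m, n)) : inner A (B - C) = inner A B - inner A C.
Proof.
rewrite /inner -sumrB; apply: eq_bigr => i _; rewrite -sumrB.
by apply: eq_bigr => j _; rewrite !mxE mulrBr.
Qed.

Lemma innerDr m n (A B C : 'M[R]_(m, n)) : inner A (B + C) = inner A B + inner A C.
Proof.
rewrite /inner -big_split; apply: eq_bigr => i _; rewrite -big_split.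
by apply: eq_bigr => j _; rewrite !mxE mulrDr.
Qed.

Lemma inner0 m n (A : 'M[R]_(m, n)) : inner A 0 = 0.
Proof. by rewrite /inner big1 // => i _; rewrite big1 // => j _; rewrite mxE mulr0. Qed.

Lemma inner0l m n (A : 'M[R]_(m, n)) : inner 0 A = 0.
Proof. by rewrite /inner big1 // => i _; rewrite big1 // => j _; rewrite mxE mul0r. Qed.

Lemma inner_suml m n (I : Type) (s : seq I) (c : I -> R) (A : I -> 'M[R]_(m, n)) B :
  inner (\sum_(k <- s) c k *: A k) B = \sum_(k <- s) c k * inner (A k) B.
Proof.
elim: s => [|k s IH]; first by rewrite !big_nil inner0l.
rewrite !big_cons -IH /inner mulr_sumr -big_split; apply: eq_bigr => i _.
rewrite mulr_sumr -big_split; apply: eq_bigr => j _ /=.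
by rewrite !mxE; ring.
Qed.

Lemma inner_delta m n (A : 'M[R]_(m, n)) c i j :
  inner A (c *: delta_mx i j) = c * A i j.
Proof.
rewrite /inner (bigD1 i) //= (bigD1 j) //= big1 => [|j' /negbTE j'j]; last first.
  by rewrite !mxE j'j andbF !mulr0.
rewrite big1 => [|i' /negbTE i'i]; last first.
  by rewrite big1 // => j' _; rewrite !mxE i'i !mulr0.
by rewrite !mxE !eqxx /= !addr0; ring.
Qed.

Lemma inner_le_l1 m n (A B : 'M[R]_(m, n)) : inner A B <= l1 A * l1 B.
Proof.
rewrite /inner /l1 mulr_suml; apply: ler_sum => i _.
rewrite mulr_suml; apply: ler_sum => j _.
rewrite (le_trans (ler_norm _)) // normrM ler_wpM2l //; exact: le_l1.
Qed.

(** The topology of matrices is the product topology of their entries, hence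
    the bound on each entry by [e] divided by the number of entries (plus one,
    for empty matrices). *)
Lemma near_l1 m n (z : 'M[R]_(m, n)) e : 0 < e ->
  \forall h \near z, l1 (h - z) < e.
Proof.
move=> e0; pose c : R := (m * n).+1%:R.
have c0 : 0 < c by rewrite ltr0n.
exists (fun i j => [set y | `|y - z i j| < e / c]).
  move=> i j; apply/nbhs_ballP; exists (e / c); first exact: divr_gt0.
  by move=> y; rewrite /ball /= distrC.
move=> h hz /=.
have : l1 (h - z) <= \sum_(i < m) \sum_(j < n) e / c.
  apply: ler_sum => i _; apply: ler_sum => j _.
  by rewrite !mxE ltW //; exact: hz.
move=> /le_lt_trans; apply.
rewrite !sumr_const !card_ord -mulrnA -mulr_natl mulrCA gtr_pMr //.
by rewrite ltr_pdivrMr // mul1r ltr_nat mulnC.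
Qed.

End MatrixTopology.

(** * Lower semicontinuity and compactness *)

Section Lsc.
Context {R : realType}.
Implicit Types T U : topologicalType.

Lemma lsc_comp T U (g : U -> T) (F : T -> \bar R) :
  continuous g -> lower_semicontinuous F -> lower_semicontinuous (F \o g).
Proof.
by move=> cg lF x a /lF [V xV Va]; exists (g @^-1` V); [exact: cg|move=> y /Va].
Qed.

(** In [\bar R] the sum of [-oo] and [+oo] is [-oo], so that a lower bound on a
    sum splits only between terms different from [-oo]. *)
Lemma lte_addP (x y : \bar R) (a : R) : x != -oo%E -> y != -oo%E ->
  (a%:E < x + y)%E -> exists b c : R, [/\ a <= b + c, (b%:E < x)%E & (c%:E < y)%E].
Proof.
case: x => [x||]; case: y => [y||] //= _ _; rewrite ?lte_fin => axy.
- exists (x - (x + y - a) / 2), (y - (x + y - a) / 2).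
  by rewrite !lte_fin; split; lra.
- exists (x - 1), (a - x + 1); rewrite lte_fin ltry; split => //; lra.
- exists (a - y + 1), (y - 1); rewrite lte_fin ltry; split => //; lra.
- exists a, 0; rewrite !ltry; split => //; lra.
Qed.

Lemma lsc_add T (F G : T -> \bar R) :
  (forall x, F x != -oo%E) -> (forall x, G x != -oo%E) ->
  lower_semicontinuous F -> lower_semicontinuous G ->
  lower_semicontinuous (fun x => (F x + G x)%E).
Proof.
move=> F1 G1 lF lG x a.
move=> /(lte_addP (F1 x) (G1 x)) [b [c [abc /lF [V xV bV] /lG [W xW cW]]]].
exists (V `&` W); first exact: filterI.
move=> y [/bV b_lt /cW c_lt]; rewrite (le_lt_trans _ (lteD b_lt c_lt)) //.
Qed.

Lemma lsc_scale T (c : R) (F : T -> \bar R) : 0 <= c ->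
  lower_semicontinuous F -> lower_semicontinuous (fun x => (c%:E * F x)%E).
Proof.
rewrite le_eqVlt => /predU1P[<- _ x a ax|c0 lF x a].
  by exists setT; [exact: filterT | move=> y _; move: ax; rewrite !mul0e].
rewrite -lte_pdivrMl // -EFinM => /lF [V xV aV].
by exists V => // y /aV; rewrite EFinM lte_pdivrMl.
Qed.

Lemma scale_neqNy (c : R) (x : \bar R) : 0 <= c -> x != -oo%E -> (c%:E * x)%E != -oo%E.
Proof.
case: x => [x||] //; rewrite le_eqVlt => /predU1P[<- _|c0 _]; first by rewrite mul0e.
by rewrite gt0_muley // lte_fin.
Qed.

Lemma lsc_sum T (I : Type) (s : seq I) (F : I -> T -> \bar R) :
  (forall i x, F i x != -oo%E) -> (forall i, lower_semicontinuous (F i)) ->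
  lower_semicontinuous (fun x => (\sum_(i <- s) F i x)%E).
Proof.
move=> F1 lF; have S1 s' x : (\sum_(i <- s') F i x)%E != -oo%E.
  by elim: s' => [|i s' IH]; rewrite ?big_nil // big_cons adde_eq_ninfty negb_or F1.
elim: s => [x a|i s IH].
  by rewrite big_nil => a0; exists setT => [|y _]; [exact: filterT|rewrite big_nil].
have -> : (fun x => \sum_(i <- i :: s) F i x)%E =
    (fun x => F i x + \sum_(i <- s) F i x)%E.
  by apply/funext => y; rewrite big_cons.
exact: lsc_add.
Qed.

Lemma lsc_sup T (I : Type) (D : set I) (F : I -> T -> \bar R) :
  (forall i, D i -> lower_semicontinuous (F i)) ->
  lower_semicontinuous (fun x => ereal_sup [set F i x | i in D]).
Proof.
move=> lF x a /ereal_sup_gt [_ [i Di <-] /(lF i Di) [V xV Va]].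
exists V => // y /Va /lt_le_trans; apply.
by apply: ereal_sup_ubound; exists i.
Qed.

(** This is the tube lemma: a strict lower bound on the objective over the
    compact slice at [h] persists over the slices at nearby points. The
    hypothesis is stated as an implication in order to cover at once the points
    that are infeasible at [h] and must remain so nearby. *)
Lemma lsc_inf T U (K : set U) (feas : T -> set U) (obj : T -> U -> \bar R) :
  compact K -> (forall h, feas h `<=` K) ->
  (forall h u (a : R), K u -> (feas h u -> (a%:E < obj h u)%E) ->
     \forall q \near (u, h), feas q.2 q.1 -> (a%:E < obj q.2 q.1)%E) ->
  lower_semicontinuous (fun h => ereal_inf [set obj h u | u in feas h]).
Proof.
move=> cK fK near_obj h a a_lt.
have [a' aa' a'_lt] : exists2 a' : R, a < a' &
    (a'%:E < ereal_inf [set obj h u | u in feas h])%E.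
  move: a_lt; case: ereal_inf => [b||] //; rewrite ?lte_fin => ab.
    by exists ((a + b) / 2); rewrite ?lte_fin; lra.
  by exists (a + 1); rewrite ?ltry ?ltrDl.
exists [set h' | forall u, K u -> feas h' u -> (a'%:E < obj h' u)%E].
  move/compact_near_coveringP: cK => /(_ T (nbhs h)
    (fun h' u => feas h' u -> (a'%:E < obj h' u)%E)); apply => u Ku.
  apply: near_obj => // fu; apply: lt_le_trans a'_lt _.
  by apply: ereal_inf_lbound; exists u.
move=> h' h'P; apply: (@lt_le_trans _ _ a'%:E); first by rewrite lte_fin.
apply: le_ereal_inf_tmp => _ [u fu <-]; apply/ltW/h'P => //; exact: fK fu.
Qed.

(** Each point has a neighbourhood on which some integer bound holds, and
    compactness makes one integer suffice. *)
Lemma lsc_compact_lbound T (K : set T) (F : T -> \bar R) : compact K ->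
  lower_semicontinuous F -> (forall x, K x -> F x != -oo%E) ->
  exists C : R, forall x, K x -> (C%:E <= F x)%E.
Proof.
move=> /compact_near_coveringP cK lF F1.
have /= [N _ NP] : \forall N \near \oo, K `<=` [set x | ((- N%:R)%:E <= F x)%E].
  apply: cK => x Kx.
  have [N Nx] : exists N : nat, ((- N%:R)%:E < F x)%E.
    move: (F1 _ Kx); case: (F x) => [r||] // _; last by exists 0%N; rewrite ltry.
    exists (Num.Def.archi_bound `|r|); rewrite lte_fin ltrNl.
    by rewrite (le_lt_trans (ler_norm _)) // normrN archi_boundP.
  have [V xV VN] := lF _ _ Nx.
  exists (V, [set N' | (N <= N')%N]); first by split => //; exists N.
  move=> [y N'] [/= /VN Ny NN']; apply: le_trans (ltW Ny).
  by rewrite lee_fin lerN2 ler_nat.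
by exists (- N%:R) => x Kx; exact: (NP N (leqnn N) x Kx).
Qed.

Lemma finite_ubound (I : finType) (Z : I -> \bar R) :
  (forall i, (Z i < +oo)%E) -> exists B : R, forall i, (Z i <= B%:E)%E.
Proof.
move=> Zy; exists (\sum_i `|fine (Z i)|) => i.
move: (Zy i); case E : (Z i) => [z||] // _; rewrite ?leNye //.
by rewrite lee_fin (bigD1 i) //= E /= (le_trans (ler_norm _)) // lerDl sumr_ge0.
Qed.

End Lsc.

(** * Histories of decisions *)

Section Histories.
Context {R : realType} {pb : msp R}.

Lemma Xprod_snoc s (h : 'M[R]_(dimx pb, s)) x :
  Xprod pb s h -> Xset pb s.+1 x -> Xprod pb s.+1 (snoc h x).
Proof.
move=> Xh Xx i; case: (unliftP ord_max i) => [j|] ->.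
  have -> : col (lift ord_max j) (snoc h x) = col j h.
    by apply/matrixP => a b; rewrite !mxE liftK.
  by rewrite lift_max; exact: Xh.
have -> : col ord_max (snoc h x) = x; last exact: Xx.
by apply/matrixP => a b; rewrite !mxE unlift_none (ord1 b).
Qed.

Lemma snoc_col s (h : 'M[R]_(dimx pb, s.+1)) :
  snoc (col' ord_max h) (col ord_max h) = h.
Proof.
apply/matrixP => i j; rewrite !mxE.
by case: unliftP => [j'|] ->; rewrite ?mxE.
Qed.

(** Histories with one more column are the image of a product of compact sets
    under the continuous map [snoc]. *)
Lemma compact_Xprod s : (forall t, (1 <= t <= s)%N -> compact (Xset pb t)) ->
  compact (Xprod pb s).
Proof.
elim: s => [|s IH] cX.
  have -> : Xprod pb 0 = [set 0]; last exact: compact_set1.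
  apply/seteqP; split=> h _ /=; first by rewrite thinmx0.
  by case.
have -> : Xprod pb s.+1 =
    (fun q => snoc q.2 q.1) @` (Xset pb s.+1 `*` Xprod pb s).
  apply/seteqP; split=> [h Xh /=|_ [[x h] [/= Xx Xh] <-]]; last exact: Xprod_snoc.
  exists (col ord_max h, col' ord_max h); last by rewrite snoc_col.
  split; first exact: (Xh ord_max).
  move=> i; have -> : col i (col' ord_max h) = col (lift ord_max i) h.
    by apply/matrixP => a b; rewrite !mxE.
  by have := Xh (lift ord_max i); rewrite lift_max.
apply: continuous_compact; first exact/continuous_subspaceT/continuous_snoc.
apply: compact_setX; first by apply: cX; rewrite ltnS leqnn.
by apply: IH => t /andP[t1 ts]; apply: cX; rewrite t1 ltnW.
Qed.

Lemma fatten_snoc s (eps : R) (h : 'M[R]_(dimx pb, s)) x :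
  fatten eps (Xprod pb s) h -> Xset pb s.+1 x ->
  fatten eps (Xprod pb s.+1) (snoc h x).
Proof.
move=> [z Xz [u /= u1 <-]] Xx; exists (snoc z x); first exact: Xprod_snoc.
exists (snoc u 0); rewrite /=.
  suff -> : enorm (snoc u 0) = enorm u by [].
  congr Num.sqrt; apply: eq_bigr => i _.
  rewrite big_ord_recr /= !mxE unlift_none ?mxE mulr0 addr0.
  apply: eq_bigr => j _; rewrite !mxE.
  suff -> : widen_ord (leqnSn s) j = lift ord_max j by rewrite liftK.
  by apply: val_inj; rewrite /= /bump leqNgt ltn_ord.
apply/matrixP => i j; rewrite !mxE; case: unliftP => [j'|] _; rewrite ?mxE //.
by rewrite mulr0 addr0.
Qed.

Lemma fatten_sub (eps : R) m n (Z : set 'M[R]_(m, n)) : Z `<=` fatten eps Z.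
Proof.
move=> z Zz; exists z => //; exists 0; last by rewrite scaler0 addr0.
by rewrite /= /enorm inner0 sqrtr0.
Qed.

Lemma fatten_delta (eps c : R) m n (Z : set 'M[R]_(m, n)) z i j :
  Z z -> `|c| <= 1 -> fatten eps Z (z + (eps * c) *: delta_mx i j).
Proof.
move=> Zz c1; exists z => //; exists (c *: delta_mx i j); last by rewrite scalerA.
rewrite /= /enorm inner_delta !mxE !eqxx mulr1 -expr2 sqrtr_sqr.
exact: c1.
Qed.

Lemma continuous_linmap t (v : xi_type pb t) : continuous (linmap v).
Proof.
apply: continuous_mx => i j.
have -> : (fun h => linmap v h i j) = (fun h => (noise_A v ord0 *m x0 pb) i j +
    \sum_(c < t) \sum_k noise_A v (lift ord0 c) i k * h k c).
  apply/funext => h; rewrite /linmap mxE summxE; congr (_ + _).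
  apply: eq_bigr => c _; rewrite mxE; apply: eq_bigr => k _.
  by rewrite [X in _ * X]mxE.
have cD : continuous (fun q : R * R => q.1 + q.2) := @add_continuous R^o.
have cS : continuous (fun h : 'M[R]_(dimx pb, t) =>
    \sum_(c < t) \sum_k noise_A v (lift ord0 c) i k * h k c).
  apply: (continuous_big cD) => c _; apply: (continuous_big cD) => k _ h.
  apply: (@continuous_comp _ _ _ (fun h : 'M[R]_(dimx pb, t) => h k c) ( *%R _)).
    exact: coord_continuous.
  exact: (@mulrl_continuous R _).
by move=> h; exact: (@cvgD R R^o _ _ _ _ _ _ _ (cvg_cst _) (cS h)).
Qed.

End Histories.

(** * Dynamic programming equations *)

Section DynamicProgramming.
Context {R : realType}.

(** The last two fields concern the fattened set of histories: they make the
    recourse functions finite around every feasible history, which is what will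
    bound the slopes of the cuts. *)
Record wellposed (pb : msp R) (eps : R) : Prop := Wellposed {
  wp_eps : 0 < eps ;
  wp_cost : forall t (h : 'M[R]_(dimx pb, t)) psi,
    (1 <= t <= nstages pb)%N -> cost pb h psi != -oo%E ;
  wp_ambig : forall t p, (2 <= t <= nstages pb)%N -> ambig pb t p ->
    (forall j, 0 <= p j ord0 * Phi pb t j) /\
    \sum_j p j ord0 * Phi pb t j = 1 ;
  wp_compact : forall t, (1 <= t <= nstages pb)%N -> compact (Xset pb t) ;
  wp_cost_lsc : forall t j, (1 <= t <= nstages pb)%N ->
    lower_semicontinuous (fun h : 'M[R]_(dimx pb, t) =>
      cost pb h (noise_Psi (outcome pb t j))) ;
  wp_constr_lsc : forall t j i, (1 <= t <= nstages pb)%N ->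
    lower_semicontinuous (fun h : 'M[R]_(dimx pb, t) =>
      (constr pb (x0 pb) h (noise_Psi (outcome pb t j)) i ord0)%:E) ;
  wp_dom : forall s j (h : 'M[R]_(dimx pb, s)) x, (s < nstages pb)%N ->
    fatten eps (Xprod pb s) h -> Xset pb s.+1 x ->
    (cost pb (snoc h x) (noise_Psi (outcome pb s.+1 j)) < +oo)%E ;
  wp_feasible : forall s j (h : 'M[R]_(dimx pb, s)), (s < nstages pb)%N ->
    fatten eps (Xprod pb s) h -> feasible h (outcome pb s.+1 j) !=set0
}.

(** The dual representation of the risk measures turns the recursion that
    defines the recourse functions into this one, in which no random variable
    occurs any more. *)
Record dp_solution (pb : msp R)
    (Q : forall s, 'M[R]_(dimx pb, s) -> \bar R) : Prop := DpSolution {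
  dp_last : forall h, Q (nstages pb) h = 0%E ;
  dp_step : forall s h, (1 <= s < nstages pb)%N ->
    Q s h = ereal_sup [set weighted s.+1 p
      (fun j => stage_value (@Q s.+1) h (outcome pb s.+1 j)) | p in ambig pb s.+1]
}.

Context {pb : msp R} {eps : R} (wp : wellposed pb eps).

Lemma weighted_le t (p : 'cV[R]_(nscen pb)) (Z Z' : 'I_(nscen pb) -> \bar R) :
  (2 <= t <= nstages pb)%N -> ambig pb t p -> (forall j, (Z j <= Z' j)%E) ->
  (weighted t p Z <= weighted t p Z')%E.
Proof.
move=> tT /(wp_ambig wp tT) [p0 _] ZZ'; apply: lee_sum => j _.
by apply: lee_wpmul2l; rewrite // lee_fin.
Qed.

Lemma weighted_cst t (p : 'cV[R]_(nscen pb)) (c : \bar R) :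
  (2 <= t <= nstages pb)%N -> ambig pb t p -> weighted t p (fun=> c) = c.
Proof.
move=> tT /(wp_ambig wp tT) [p0 p1]; rewrite /weighted -ge0_sume_distrl.
  by rewrite sumEFin p1 mul1e.
by move=> j _; rewrite lee_fin.
Qed.

Lemma weightedD t (p : 'cV[R]_(nscen pb)) (Z : 'I_(nscen pb) -> \bar R)
    (z : 'I_(nscen pb) -> R) :
  weighted t p (fun j => (Z j + (z j)%:E)%E) =
  (weighted t p Z + (\sum_j p j ord0 * Phi pb t j * z j)%:E)%E.
Proof.
rewrite /weighted -sumEFin -big_split; apply: eq_bigr => j _ /=.
by rewrite muleDr // fin_num_adde_defl.
Qed.

Lemma stage_value_le s V (h : 'M[R]_(dimx pb, s)) v x :
  feasible h v x -> (stage_value V h v <= stage_obj V h v x)%E.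
Proof. by move=> fx; apply: ereal_inf_lbound; exists x. Qed.

Lemma le_stage_value s V (h : 'M[R]_(dimx pb, s)) v c :
  (forall x, feasible h v x -> (c <= stage_obj V h v x)%E) ->
  (c <= stage_value V h v)%E.
Proof. by move=> cP; apply: le_ereal_inf_tmp => _ [x fx <-]; exact: cP. Qed.

Lemma stage_value_mono s V V' (h : 'M[R]_(dimx pb, s)) v :
  (forall h', (V h' <= V' h')%E) -> (stage_value V h v <= stage_value V' h v)%E.
Proof.
move=> VV'; apply: le_stage_value => x fx.
by apply: (le_trans (stage_value_le V fx)); exact: leeD2l.
Qed.

Lemma stage_value_lty s V (h : 'M[R]_(dimx pb, s)) j : (s < nstages pb)%N ->
  (forall h', fatten eps (Xprod pb s.+1) h' -> (V h' < +oo)%E) ->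
  fatten eps (Xprod pb s) h ->
  (stage_value V h (outcome pb s.+1 j) < +oo)%E.
Proof.
move=> sT Vy hF; have [x fx] := wp_feasible wp j sT hF; have [Xx _ _] := fx.
apply: (le_lt_trans (stage_value_le V fx)).
by apply: lte_add_pinfty; [exact: (wp_dom wp)|apply/Vy/fatten_snoc].
Qed.

Lemma near_infeasible s j (h : 'M[R]_(dimx pb, s)) x : (s < nstages pb)%N ->
  Xset pb s.+1 x -> ~ feasible h (outcome pb s.+1 j) x ->
  \forall q \near (x, h), ~ feasible q.2 (outcome pb s.+1 j) q.1.
Proof.
move=> sT Xx nf; set v := outcome _ _ _ in nf *.
have [gx|] := pselect (glevel (noise_Psi v) (snoc h x)); last first.
  move=> /existsNP [i /negP]; rewrite -ltNge -lte_fin => g0.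
  have [V xV Vg] := lsc_comp (@continuous_snoc R _ s) (@wp_constr_lsc _ _ wp s.+1 j i sT)
    (g0 : (0%:E < _ (x, h))%E).
  apply: filterS xV => q /Vg /=; rewrite lte_fin => gq [_ /(_ i) gq' _].
  by move: (lt_le_trans gq gq'); rewrite ltxx.
have nl : linmap v (snoc h x) <> noise_b v by move=> lx; apply: nf.
have cl : closed [set noise_b v].
  by apply: compact_closed; [exact: hausdorff_mx | exact: compact_set1].
have cL : continuous (fun q : 'cV[R]_(dimx pb) * 'M[R]_(dimx pb, s) =>
    linmap v (snoc q.2 q.1)).
  move=> q; apply: (@continuous_comp _ _ _ (fun q => snoc q.2 q.1) (linmap v)).
    exact: continuous_snoc.
  exact: continuous_linmap.
have nb : nbhs (linmap v (snoc h x)) (~` [set noise_b v]).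
  by apply: open_nbhs_nbhs; split => //; exact: closed_openC.
have : \forall q \near (x, h), linmap v (snoc q.2 q.1) <> noise_b v.
  exact: (cL (x, h) _ nb).
by apply: filterS => q nq [_ _ lq]; exact: nq.
Qed.

(** The stage objective is jointly lower semicontinuous in the history and in
    the decision, while feasibility is a closed condition. *)
Lemma near_stage_obj s V j (h : 'M[R]_(dimx pb, s)) x (a : R) : (s < nstages pb)%N ->
  (forall h', V h' != -oo%E) -> lower_semicontinuous V -> Xset pb s.+1 x ->
  (feasible h (outcome pb s.+1 j) x ->
    (a%:E < stage_obj V h (outcome pb s.+1 j) x)%E) ->
  \forall q \near (x, h), feasible q.2 (outcome pb s.+1 j) q.1 ->
    (a%:E < stage_obj V q.2 (outcome pb s.+1 j) q.1)%E.
Proof.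
move=> sT V1 lV Xx; have [fx /(_ fx) ax|nf _] :=
  pselect (feasible h (outcome pb s.+1 j) x); last first.
  by apply: filterS (near_infeasible sT Xx nf) => q nq /nq.
have lsc_obj : lower_semicontinuous
    (fun h' => cost pb h' (noise_Psi (outcome pb s.+1 j)) + V h')%E.
  by apply: lsc_add => // [h'|]; [exact: (wp_cost wp) | exact: (wp_cost_lsc wp)].
have [W xW Wa] := lsc_comp (@continuous_snoc R _ s) lsc_obj
  (ax : (a%:E < _ (x, h))%E).
by apply: filterS xW => q /Wa.
Qed.

Lemma stage_value_lsc s V j : (s < nstages pb)%N ->
  (forall h', V h' != -oo%E) -> lower_semicontinuous V ->
  lower_semicontinuous (fun h : 'M[R]_(dimx pb, s) =>
    stage_value V h (outcome pb s.+1 j)).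
Proof.
move=> sT V1 lV; apply: (@lsc_inf _ _ _ (Xset pb s.+1)).
- exact: (wp_compact wp).
- by move=> h x [].
- by move=> h x a; exact: near_stage_obj.
Qed.

Lemma stage_value_neqNy s V j (h : 'M[R]_(dimx pb, s)) : (s < nstages pb)%N ->
  (forall h', V h' != -oo%E) -> lower_semicontinuous V ->
  stage_value V h (outcome pb s.+1 j) != -oo%E.
Proof.
move=> sT V1 lV; set F := fun h' => (cost pb h' (noise_Psi (outcome pb s.+1 j)) + V h')%E.
have F1 h' : F h' != -oo%E by rewrite adde_eq_ninfty negb_or V1 (wp_cost wp).
have lF : lower_semicontinuous F.
  by apply: lsc_add => // [h'|]; [exact: (wp_cost wp) | exact: (wp_cost_lsc wp)].
have cX : compact [set snoc h x | x in Xset pb s.+1].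
  apply: continuous_compact; last exact: (wp_compact wp).
  apply/continuous_subspaceT => x.
  apply: (@continuous_comp _ _ _ (fun x => (x, h)) (fun q => snoc q.2 q.1)).
    move=> A [[B C] [/= xB hC] BC]; apply: (@filterS _ _ _ _ _ _ xB) => y By.
    by apply: BC; split => //; exact: nbhs_singleton.
  exact: (@continuous_snoc R _ s (x, h)).
have [C CF] := lsc_compact_lbound cX lF (fun x _ => F1 x).
apply: contra_notN (_ : ~ (stage_value V h (outcome pb s.+1 j) < C%:E)%E) => [/eqP->|].
  exact: ltNyr.
apply/negP; rewrite -leNgt; apply: le_stage_value => x [Xx _ _].
by apply: CF; exists x.
Qed.

Context {Q : forall s, 'M[R]_(dimx pb, s) -> \bar R} (Qdp : dp_solution Q).

Lemma backward_ind (C : nat -> Prop) : C (nstages pb) ->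
  (forall s, (1 <= s < nstages pb)%N -> C s.+1 -> C s) ->
  forall s, (1 <= s <= nstages pb)%N -> C s.
Proof.
move=> CT Cs s /andP[s1 sT].
have [n] := ubnP (nstages pb - s); elim: n s s1 sT => // n IH s s1 sT sn.
have [->//|sT'] := eqVneq s (nstages pb).
by apply: Cs; [|apply: IH]; lia.
Qed.

(** A risk measure is at most the worst outcome, and each outcome has a feasible
    decision of finite cost. *)
Lemma dp_lty s h : (1 <= s <= nstages pb)%N -> fatten eps (Xprod pb s) h ->
  (Q h < +oo)%E.
Proof.
move=> sT; move: s sT h; apply: backward_ind => [h _|s sT IH h hF].
  by rewrite (dp_last Qdp) ltry.
have sT' : (s < nstages pb)%N by lia.
have sT2 : (1 < s.+1 <= nstages pb)%N by lia.
rewrite (dp_step Qdp) //.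
pose Z j := stage_value (@Q s.+1) h (outcome pb s.+1 j).
have Zy j : (Z j < +oo)%E by exact: stage_value_lty.
have [B ZB] := finite_ubound Zy.
apply: (@le_lt_trans _ _ B%:E); last exact: ltry.
apply: ge_ereal_sup => _ [p pA <-].
by rewrite -(weighted_cst B%:E sT2 pA); exact: weighted_le.
Qed.

(** Lower semicontinuity passes to the stage values by compactness of the sets
    of decisions, then to nonnegative combinations and to suprema. Values
    different from [-oo] are carried along because they are what makes sums of
    lower semicontinuous functions lower semicontinuous. *)
Lemma dp_lsc : (forall s, (1 <= s < nstages pb)%N -> ambig pb s.+1 !=set0) ->
  forall s, (1 <= s <= nstages pb)%N ->
  (forall h, @Q s h != -oo%E) /\ lower_semicontinuous (@Q s).
Proof.
move=> A0; apply: backward_ind => [|s sT [IH1 IH2]].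
  split=> [h|h a]; rewrite (dp_last Qdp) // => a0.
  by exists setT => [|h' _]; [exact: filterT | rewrite (dp_last Qdp)].
have sT' : (s < nstages pb)%N by lia.
have sT2 : (1 < s.+1 <= nstages pb)%N by lia.
have -> : @Q s = fun h => ereal_sup [set weighted s.+1 p
    (fun j => stage_value (@Q s.+1) h (outcome pb s.+1 j)) | p in ambig pb s.+1].
  by apply/funext => h; rewrite (dp_step Qdp).
have Z1 p : ambig pb s.+1 p -> forall j h, ((p j ord0 * Phi pb s.+1 j)%:E *
    stage_value (@Q s.+1) h (outcome pb s.+1 j))%E != -oo%E.
  move=> pA j h; apply: scale_neqNy; first exact: (wp_ambig wp sT2 pA).1.
  exact: stage_value_neqNy.
split=> [h|].
  have [p pA] := A0 s sT.
  rewrite -ltNye; apply: (@lt_le_trans _ _ (weighted s.+1 p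
    (fun j => stage_value (@Q s.+1) h (outcome pb s.+1 j)))).
    rewrite ltNye /weighted; elim/big_ind: _ => // [x y x1 y1|j _].
      by rewrite adde_eq_ninfty negb_or x1 y1.
    exact: Z1.
  by apply: ereal_sup_ubound; exists p.
apply: lsc_sup => p pA; apply: lsc_sum => [j h|j]; first exact: Z1.
apply: lsc_scale; first exact: (wp_ambig wp sT2 pA).1.
exact: stage_value_lsc.
Qed.

End DynamicProgramming.

(** * Nodes and histories of a run *)

Section Nodes.
Context {R : realType} {pb : msp R} {Omega : Type} (r : run pb Omega).
Implicit Types n m : node (nscen pb).

Lemma parent_child n j : parent (child n j) = n.
Proof. by case: n. Qed.

Lemma stage_child n j : stage_of (child n j) = (stage_of n).+1.
Proof. by case: n. Qed.

Lemma stage_iter_parent i n : stage_of (iter i (@parent _) n) = (stage_of n - i)%N.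
Proof.
have stage_parent m : stage_of (parent m) = (stage_of m).-1 by case: m => [|[|]].
by elim: i => [|i IH]; rewrite ?subn0 //= stage_parent IH subnS.
Qed.

Lemma child_parentE (hM : (0 < nscen pb)%N) n : (0 < stage_of n)%N ->
  exists j, n = child (parent n) j.
Proof. by case: n => [|[|j l]] //= _; [exists (Ordinal hM) | exists j]. Qed.

Lemma run_hist_child k s n j w :
  run_hist r k s.+1 (child n j) w =
  snoc (run_hist r k s n w) (dec r k (child n j) w).
Proof.
apply/matrixP => i a; case: (unliftP ord_max a) => [a'|] ->; last first.
  by rewrite snoc_last mxE /= subnn.
rewrite snocE !mxE lift_max subSn ?ltn_ord // iterSr parent_child.
by congr (dec r k (iter _ _ _) _ _ _).
Qed.

Lemma run_hist_Xprod k s n w :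
  (forall m, (1 <= stage_of m <= s)%N -> Xset pb (stage_of m) (dec r k m w)) ->
  stage_of n = s -> Xprod pb s (run_hist r k s n w).
Proof.
move=> decX ns a; have sa : stage_of (iter (s - a.+1) (@parent _) n) = a.+1.
  by rewrite stage_iter_parent ns subKn.
have -> : col a (run_hist r k s n w) = dec r k (iter (s - a.+1) (@parent _) n) w.
  by apply/matrixP => i c; rewrite !mxE (ord1 c).
by have := decX (iter (s - a.+1) (@parent _) n); rewrite sa; apply; exact: ltn_ord.
Qed.

Lemma stage_sampled_node k t w : stage_of (sampled_node r k t w) = t.
Proof. by elim: t => //= t IH; rewrite stage_child IH. Qed.

End Nodes.

(** * Bounds on subgradients *)

Section SubgradientBound.
Context {R : realType}.

(** A subgradient at [h] is bounded by the increments of the function between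
    [h] and the points at distance [eps] from [h] along the coordinate axes. For
    [h] close to [z], the axis points of [z] do almost as well as those of [h],
    and there are finitely many of them; hence a bound that is uniform near [z],
    and then on [K] by compactness. The bound depends on [F] only through
    [C] and [G], so that it serves all iterations of the algorithm at once. *)
Lemma subgradient_bound m n (K : set 'M[R]_(m, n)) (G : 'M[R]_(m, n) -> \bar R)
    (C eps : R) : compact K -> 0 < eps ->
  (forall y, fatten eps K y -> (G y < +oo)%E) ->
  exists B : R, forall F h pi, K h -> (C%:E <= F h)%E ->
    (forall y, (F y <= G y)%E) -> is_subgradient F h pi -> l1 pi <= B.
Proof.
move=> /compact_near_coveringP cK eps0 Gy.
have /= [N _ NP] : \forall N \near \oo, K `<=` [set h | forall F pi,
    (C%:E <= F h)%E -> (forall y, (F y <= G y)%E) -> is_subgradient F h pi ->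
    l1 pi <= N%:R].
  apply: cK => z Kz.
  pose sg (b : bool) : R := if b then 1 else -1.
  have [g gP] : exists g : R, forall q : 'I_m * 'I_n * bool,
      (G (z + (eps * sg q.2) *: delta_mx q.1.1 q.1.2)%R <= g%:E)%E.
    apply: finite_ubound => q; apply/Gy/fatten_delta => //.
    by rewrite /sg; case: q.2; rewrite ?normrN normr1.
  pose c : R := (m * n)%:R; have c0 : 0 <= c by rewrite ler0n.
  (* With this radius the error made by using the axis points of [z], summed
     over all coordinates, is at most half of [eps * l1 pi]. *)
  pose del := eps / (2 * (c + 1)).
  have del0 : 0 < del by apply: divr_gt0 => //; lra.
  pose N := Num.Def.archi_bound `|2 * c * (g - C) / eps|.
  exists ([set h | l1 (h - z) < del], [set N' | (N <= N')%N]).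
    by split; [exact: near_l1 | exists N].
  move=> [h N'] [/= hz NN'] F pi CF FG [Ffin Fsub].
  apply: (@le_trans _ _ N%:R); last by rewrite ler_nat.
  have /ltW : `|2 * c * (g - C) / eps| < N%:R by exact: archi_boundP.
  apply: le_trans; apply: le_trans (ler_norm _).
  rewrite ler_pdivlMr //.
  have coord i j : eps * `|pi i j| <= g - C + l1 pi * del.
    pose b := 0 <= pi i j.
    have := le_trans (Fsub (z + (eps * sg b) *: delta_mx i j)) (FG _).
    move=> /le_trans /(_ (gP (i, j, b))).
    rewrite -(fineK Ffin) -EFinD lee_fin.
    have CF' : C <= fine (F h) by rewrite -lee_fin fineK.
    rewrite innerBr innerDr inner_delta => le_g.
    have := inner_le_l1 pi (h - z).
    have : l1 pi * l1 (h - z) <= l1 pi * del by rewrite ler_wpM2l ?l1_ge0 // ltW.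
    have -> : eps * `|pi i j| = eps * sg b * pi i j.
      rewrite -mulrA; congr (_ * _); rewrite /sg /b.
      case: ifPn => [/ger0_norm -> | /negP/negP]; first by rewrite mul1r.
      by rewrite -ltNge mulN1r => /ltr0_norm.
    move: le_g; rewrite innerBr; lra.
  have : eps * l1 pi <= c * (g - C + l1 pi * del).
    rewrite mulr_sumr.
    apply: (@le_trans _ _ (\sum_(i < m) \sum_(j < n) (g - C + l1 pi * del))).
      by apply: ler_sum => i _; rewrite mulr_sumr; apply: ler_sum.
    by rewrite !sumr_const !card_ord -mulrnA -mulr_natl mulnC.
  have : c * del * l1 pi <= eps / 2 * l1 pi.
    rewrite ler_wpM2r ?l1_ge0 // /del mulrCA ler_pM2l //.
    by rewrite invfM mulrCA ler_piMr ?invr_ge0 // ler_pdivrMr; lra.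
  by move: (l1 pi) => x; nra.
by exists N%:R => F h pi Kh; exact: (NP N (leqnn N) h Kh).
Qed.

End SubgradientBound.

(** * Cuts along one sample path *)

Section Path.
Context {R : realType} {pb : msp R} {eps : R} (wp : wellposed pb eps).
Context {Q : forall s, 'M[R]_(dimx pb, s) -> \bar R} (Qdp : dp_solution Q).
Context {Omega : Type} {r : run pb Omega} {w : Omega} (alg : run_spec r w).
Implicit Types n m : node (nscen pb).

Local Notation cut k s := (@cut_model R pb Omega r k s w).
Local Notation hist k s n := (run_hist r k s n w).
Local Notation stage_cut k s j :=
  (fun h => stage_value (cut k s.+1) h (outcome pb s.+1 j)).

Lemma ambig_neq0 s : (1 <= s < nstages pb)%N -> ambig pb s.+1 !=set0.
Proof. by move=> sT; have [p [pi [_ [pA _] _ _]]] := alg_cut alg 0 sT; exists p. Qed.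

Lemma affine_cut_Ny l s (h : 'M[R]_(dimx pb, s)) :
  theta r l s w = -oo%E -> affine_cut r l w h = -oo%E :> \bar R.
Proof. by rewrite /affine_cut => ->. Qed.

Lemma le_cut l k s h : (l <= k)%N -> (@affine_cut R pb Omega r l s w h <= cut k s h)%E.
Proof.
rewrite -ltnS => lk.
exact: (@le_bigmax _ _ _ _ (fun l : 'I_k.+1 => affine_cut r l w h) (Ordinal lk)).
Qed.

Lemma cut_le k s h c :
  (forall l, (l <= k)%N -> (@affine_cut R pb Omega r l s w h <= c)%E) ->
  (cut k s h <= c)%E.
Proof. by move=> lc; apply: bigmax_le => [|[l lk] _]; [exact: leNye | exact: lc]. Qed.

Lemma cut_mono k k' s h : (k <= k')%N -> (cut k s h <= cut k' s h)%E.
Proof. by move=> kk'; apply: cut_le => l lk; apply: le_cut; exact: leq_trans kk'. Qed.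

(** The stage problems are then [-oo] as well, and the convention [0 * -oo = 0]
    cannot hide it because the weights sum to one. *)
Lemma theta_void k s : (1 <= s < nstages pb)%N ->
  (forall y, cut k s.+1 y = -oo%E) -> theta r k.+1 s w = -oo%E.
Proof.
move=> sT cutNy; have [p [pi [_ [pA _] -> _]]] := alg_cut alg k sT.
have sT2 : (1 < s.+1 <= nstages pb)%N by lia.
rewrite -(weighted_cst wp -oo%E sT2 pA); congr weighted; apply/funext => j.
have sT' : (s < nstages pb)%N by lia.
have [fx _] := alg_decision alg k j sT' (stage_sampled_node r k.+1 s w).
apply/eqP; rewrite -leeNy_eq; apply: (le_trans (stage_value_le _ fx)).
by rewrite /stage_obj cutNy addeNy.
Qed.

Lemma theta_fin k s : (1 <= s < nstages pb)%N ->
  (exists y, cut k s.+1 y != -oo%E) -> theta r k.+1 s w \is a fin_num.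
Proof.
move=> sT cutNy; have [p [pi [subg _ -> _]]] := alg_cut alg k sT.
apply/sum_fin_numP => j _ _; apply: fin_numM => //.
by have [[]] := subg j cutNy.
Qed.

Lemma theta_neqy k s : (1 <= s <= nstages pb)%N -> theta r k s w != +oo%E.
Proof.
move=> /andP[s1]; rewrite leq_eqVlt => /predU1P[->|sT].
  by rewrite (alg_last alg k).1.
have {}sT : (1 <= s < nstages pb)%N by rewrite s1.
case: k => [|k]; first by rewrite (alg_init alg sT).1.
have [cutNy|] := pselect (exists y, cut k s.+1 y != -oo%E).
  by have := theta_fin sT cutNy; rewrite fin_numE => /andP[].
by move=> /forallNP cutNy; rewrite theta_void // => y; apply/eqP/negP => /negP/cutNy.
Qed.

(** Every cut is valid, because the subgradient inequality for the approximate
    stage problems survives averaging with the worst-case weights, and these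
    weights are admissible in the exact risk measure. *)
Lemma cut_le_dp k s h : (1 <= s <= nstages pb)%N -> (cut k s h <= Q h)%E.
Proof.
move=> sT; move: s sT k h; apply: backward_ind => [k h|s sT IH k h].
  apply: cut_le => l _; rewrite (dp_last Qdp) /affine_cut.
  by have [-> ->] := alg_last alg l; rewrite inner0l adde0.
apply: cut_le => -[_|l _].
  by rewrite affine_cut_Ny ?leNye //; exact: (alg_init alg sT).1.
have [cutNy|] := pselect (exists y, cut l s.+1 y != -oo%E); last first.
  move=> /forallNP cutNy; rewrite affine_cut_Ny ?leNye // theta_void // => y.
  by apply/eqP/negP => /negP/cutNy.
have [p [pi [subg [pA _] thetaE betaE]]] := alg_cut alg l sT.
have sT2 : (1 < s.+1 <= nstages pb)%N by lia.
rewrite /affine_cut thetaE betaE inner_suml -weightedD (dp_step Qdp) //.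
apply: (@le_trans _ _ (weighted s.+1 p
    (fun j => stage_value (@Q s.+1) h (outcome pb s.+1 j)))); last first.
  by apply: ereal_sup_ubound; exists p.
apply: (weighted_le wp sT2 pA) => j; have [[_ sub_j] _] := subg j cutNy.
by apply: (le_trans (sub_j h)); apply: stage_value_mono => h'; exact: IH.
Qed.

(** At the visited history the new cut takes the largest admissible average of
    the approximate stage values. Each of these values is attained at a feasible
    decision, whose exact cost exceeds it by the gap at the corresponding
    child. *)
Lemma sampled_gap k s (d : R) : (1 <= s < nstages pb)%N ->
  let n := sampled_node r k.+1 s w in
  (forall j, (Q (hist k.+1 s.+1 (child n j)) <=
     cut k s.+1 (hist k.+1 s.+1 (child n j)) + d%:E)%E) ->
  (Q (hist k.+1 s n) <= cut k.+1 s (hist k.+1 s n) + d%:E)%E.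
Proof.
move=> sT n gap; have ns : stage_of n = s by exact: stage_sampled_node.
have [p [pi [_ [pA pmax] thetaE _]]] := alg_cut alg k sT.
have sT2 : (1 < s.+1 <= nstages pb)%N by lia.
have sT' : (s < nstages pb)%N by lia.
rewrite (dp_step Qdp) //; apply: ge_ereal_sup => _ [p' p'A <-].
have theta_le : (theta r k.+1 s w <= cut k.+1 s (hist k.+1 s n))%E.
  apply: le_trans (le_cut _ (leqnn _)).
  by rewrite /affine_cut subrr inner0 adde0.
apply: (@le_trans _ _ (theta r k.+1 s w + d%:E)%E); last exact: leeD2r.
rewrite thetaE.
apply: (@le_trans _ _ (weighted s.+1 p' (trial_value r k s n w) + d%:E)%E).
  have -> : d%:E = (\sum_j p' j ord0 * Phi pb s.+1 j * d)%:E.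
    by rewrite -mulr_suml (wp_ambig wp sT2 p'A).2 mul1r.
  rewrite -weightedD; apply: (weighted_le wp sT2 p'A) => j.
  have [fx xopt] := alg_decision alg k j sT' ns.
  apply: (le_trans (stage_value_le _ fx)).
  rewrite /trial_value -xopt /stage_obj -addeA; apply: leeD2l.
  by have := gap j; rewrite run_hist_child.
by apply: leeD2r; exact: pmax.
Qed.

Lemma finite_cut s : (1 <= s <= nstages pb)%N ->
  exists l, theta r l s w \is a fin_num.
Proof.
move: s; apply: backward_ind => [|s sT [l lfin]].
  by exists 0%N; rewrite (alg_last alg 0).1.
exists l.+1; apply: theta_fin => //; exists 0.
rewrite -ltNye; apply: lt_le_trans (le_cut 0 (leqnn l)).
by rewrite ltNye /affine_cut -(fineK lfin).
Qed.

Lemma affine_cut_lip l s (B : R) y y' : (l1 (beta r l s w) <= B) ->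
  (@affine_cut R pb Omega r l s w y <= affine_cut r l w y' + (B * l1 (y - y'))%:E)%E.
Proof.
move=> lB; rewrite /affine_cut -addeA; apply: leeD2l; rewrite -EFinD lee_fin.
rewrite -lerBlDl !innerBr opprB addrA addrNK -innerBr.
by apply: (le_trans (inner_le_l1 _ _)); rewrite ler_wpM2r // l1_ge0.
Qed.

Lemma cut_fin s : (1 <= s <= nstages pb)%N ->
  \forall k \near \oo, forall h, cut k s h \is a fin_num.
Proof.
move=> sT; have [l0 l0fin] := finite_cut sT; exists l0 => // k /= l0k h.
rewrite fin_numE -ltNye -ltey; apply/andP; split.
  apply: lt_le_trans (le_cut h l0k).
  by rewrite ltNye /affine_cut -(fineK l0fin).
rewrite /cut_model; elim/big_ind: _ => // [x y xy yy|l _].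
  by rewrite maxEle; case: ifP.
rewrite /affine_cut; have := theta_neqy l sT.
by case: theta => // t _; rewrite ltry.
Qed.

Context (hM : (0 < nscen pb)%N).

Lemma dec_feasible k m : (1 <= stage_of m <= nstages pb)%N ->
  Xset pb (stage_of m) (dec r k.+1 m w).
Proof.
move=> /andP[m0 mT]; have [j mE] := child_parentE hM m0.
have mS : stage_of m = (stage_of (parent m)).+1 by rewrite {1}mE stage_child.
have [[Xx _ _] _] := alg_decision alg k j (leq_trans (eq_leq (esym mS)) mT) erefl.
by rewrite mS {2}mE.
Qed.

Lemma hist_Xprod k s n : (s <= nstages pb)%N -> stage_of n = s ->
  Xprod pb s (hist k.+1 s n).
Proof.
move=> sT; apply: run_hist_Xprod => m /andP[m1 ms].
by apply: dec_feasible; rewrite m1 (leq_trans ms).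
Qed.

(** The approximate stage problems lie between a fixed lower bound, given by
    one finite cut and the compactness of the set of histories, and the exact
    stage problem, which is finite on the fattened set; so all their subgradients
    are bounded together. This holds once a finite cut is present, and the
    finitely many earlier slopes are added to the bound. *)
Lemma beta_bounded s : (1 <= s <= nstages pb)%N ->
  exists B : R, forall l, theta r l s w != -oo%E -> l1 (beta r l s w) <= B.
Proof.
move=> /andP[s1]; rewrite leq_eqVlt => /predU1P[->|sT].
  exists 0 => l _; rewrite (alg_last alg l).2 /l1 big1 // => i _.
  by rewrite big1 // => j _; rewrite mxE normr0.
have {s1}sT : (1 <= s < nstages pb)%N by rewrite s1.
have sT' : (s < nstages pb)%N by lia.
have sT2 : (1 < s.+1 <= nstages pb)%N by lia.
have [l0 l0fin] := finite_cut (s := s.+1) ltac:(lia).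
have cX : compact (Xprod pb s.+1).
  by apply: compact_Xprod => t /andP[t1 ts]; apply: (wp_compact wp); lia.
have cXs : compact (Xprod pb s).
  by apply: compact_Xprod => t /andP[t1 ts]; apply: (wp_compact wp); lia.
have /choice[B BP] : forall j, exists B : R, forall k h pi, (l0 <= k)%N ->
    Xprod pb s h -> is_subgradient (stage_cut k s j) h pi -> l1 pi <= B.
  move=> j.
  pose F h := (cost pb h (noise_Psi (outcome pb s.+1 j)) + affine_cut r l0 w h)%E.
  (* The lower bound: the cost plus one finite cut, on a compact set. *)
  have aff_lsc : lower_semicontinuous (@affine_cut R pb Omega r l0 s.+1 w).
    move=> h a; rewrite {1}/affine_cut -(fineK l0fin) lte_fin -subr_gt0.
    set g := (X in 0 < X) => g0.
    set b := l1 (beta r l0 s.+1 w).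
    have b1 : 0 < b + 1 by rewrite ltr_wpDl ?l1_ge0.
    have gb : 0 < g / (b + 1) by rewrite divr_gt0.
    exists [set h' | l1 (h' - h) < g / (b + 1)]; first exact: near_l1.
    move=> h' /=; rewrite ltr_pdivlMr // => h'h.
    have := @affine_cut_lip l0 s.+1 b h h' (lexx _).
    rewrite /affine_cut -(fineK l0fin) -!EFinD lee_fin lte_fin.
    move: h'h; rewrite -[h - h']opprB l1N /g.
    have := l1_ge0 (h' - h); nra.
  have F1 h : F h != -oo%E.
    rewrite adde_eq_ninfty negb_or (wp_cost wp) //=.
    by rewrite /affine_cut -(fineK l0fin).
  have lF : lower_semicontinuous F.
    apply: lsc_add => // [h|h|]; first exact: (wp_cost wp).
      by rewrite /affine_cut -(fineK l0fin).
    exact: (wp_cost_lsc wp).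
  have [C CF] := lsc_compact_lbound cX lF (fun h _ => F1 h).
  have Gy y : fatten eps (Xprod pb s) y ->
      (stage_value (@Q s.+1) y (outcome pb s.+1 j) < +oo)%E.
    move=> hF; apply: (stage_value_lty wp) => // h'.
    by apply: (dp_lty wp Qdp); lia.
  have [B BP] := subgradient_bound C cXs (wp_eps wp) Gy.
  exists B => k h pi lk Xh; apply: (BP _ h) => //.
    apply: le_stage_value => x [Xx _ _].
    apply: (le_trans (CF _ (Xprod_snoc Xh Xx))).
    by apply: leeD2l; exact: le_cut.
  by move=> y; apply: stage_value_mono => h'; apply: cut_le_dp; lia.
exists (\sum_j `|B j| + \sum_(l < l0.+1) l1 (beta r l s w)) => l l1fin.
have [ll0|] := leqP l l0.
  rewrite -[leLHS]add0r lerD ?sumr_ge0 //.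
  have ll0' : (l < l0.+1)%N by [].
  by rewrite (bigD1 (Ordinal ll0')) //= lerDl sumr_ge0 // => i _; exact: l1_ge0.
case: l l1fin => // l l1fin; rewrite ltnS => l0l.
rewrite -[leLHS]addr0 lerD //; last by apply: sumr_ge0 => i _; exact: l1_ge0.
have [p [pi [subg [pA _] _ ->]]] := alg_cut alg l sT.
have [p0 p1] := wp_ambig wp sT2 pA.
apply: (le_trans (l1_sum _ _)).
rewrite -[leRHS]mul1r -p1 mulr_suml; apply: ler_sum => j _.
rewrite l1Z ger0_norm // ler_wpM2l //.
have [|sub_j _] := subg j.
  exists 0; rewrite -ltNye; apply: lt_le_trans (le_cut 0 l0l).
  by rewrite ltNye /affine_cut -(fineK l0fin).
apply: (le_trans (BP j _ _ _ l0l _ sub_j)).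
  by apply: hist_Xprod; [exact: ltnW | exact: stage_sampled_node].
by rewrite (bigD1 j) //= (le_trans (ler_norm _)) // lerDl sumr_ge0.
Qed.

Lemma cut_lip s : (1 <= s <= nstages pb)%N -> exists2 B : R, 0 <= B &
  forall k y y', (cut k s y <= cut k s y' + (B * l1 (y - y'))%:E)%E.
Proof.
move=> sT; have [B BP] := beta_bounded sT; exists `|B| => // k y y'.
apply: cut_le => l lk; have [tNy|tNy] := eqVneq (theta r l s w) -oo%E.
  by rewrite affine_cut_Ny ?leNye.
have lB := le_trans (BP l tNy) (ler_norm B).
by apply: (le_trans (affine_cut_lip _ _ lB)); apply: leeD2r; exact: le_cut.
Qed.

(** The models increase, are equi-Lipschitz and bounded, so that they
    converge uniformly on the compact set of feasible histories. *)
Lemma cut_uniform_cauchy s (e : R) : (1 <= s <= nstages pb)%N -> 0 < e ->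
  \forall k \near \oo, forall k' h, Xprod pb s h ->
    (cut k' s h <= cut k s h + e%:E)%E.
Proof.
move=> sT e0; have [B B0 BP] := cut_lip sT.
have cX : compact (Xprod pb s).
  by apply: compact_Xprod => t /andP[t1 ts]; apply: (wp_compact wp); lia.
have [k0 _ k0fin] := cut_fin sT.
have /compact_near_coveringP cX' := cX.
have /= [K _ KP] : \forall K \near \oo, Xprod pb s `<=` [set h | forall k k',
    (K <= k)%N -> (cut k' s h <= cut k s h + e%:E)%E].
  apply: cX' => z Xz.
  pose S := ereal_sup [set cut k s z | k in setT].
  have cutS k : (cut k s z <= S)%E by apply: ereal_sup_ubound; exists k.
  have Sfin : S \is a fin_num.
    rewrite fin_numElt; apply/andP; split.
      apply: lt_le_trans (cutS k0); rewrite ltNye.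
      by have := k0fin k0 (leqnn _) z; rewrite fin_numE => /andP[].
    apply: (@le_lt_trans _ _ (Q z)).
      by apply: ge_ereal_sup => _ [k _ <-]; exact: cut_le_dp.
    by apply: (dp_lty wp Qdp) => //; exact: fatten_sub.
  have e30 : 0 < e / 3 by rewrite divr_gt0.
  have [_ [k1 _ <-] Sk1] := ub_ereal_sup_adherent e30 Sfin.
  have del0 : 0 < e / 3 / (B + 1) by rewrite divr_gt0 // ltr_wpDl.
  exists ([set h | l1 (h - z) < e / 3 / (B + 1)], [set K | (k1 <= K)%N]).
    by split; [exact: near_l1 | exists k1].
  move=> [h K] [/= hz k1K] k k' Kk.
  have Bhz : B * l1 (h - z) <= e / 3.
    by move: hz; rewrite ltr_pdivlMr ?ltr_wpDl //; have := l1_ge0 (h - z); nra.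
  have le1 : (cut k' s h <= cut k' s z + (e / 3)%:E)%E.
    by apply: (le_trans (BP _ _ z)); apply: leeD2l; rewrite lee_fin.
  have le2 : (cut k' s z <= cut k s z + (e / 3)%:E)%E.
    apply: (le_trans (cutS k')); rewrite -leeBlDr //.
    apply: (le_trans (ltW Sk1)).
    by apply: cut_mono; exact: leq_trans Kk.
  have le3 : (cut k s z <= cut k s h + (e / 3)%:E)%E.
    by apply: (le_trans (BP _ _ h)); apply: leeD2l; rewrite lee_fin -opprB l1N.
  have -> : e%:E = (e / 3 + e / 3 + e / 3)%:E by congr EFin; lra.
  rewrite !EFinD !addeA; apply: (le_trans le1); apply: leeD2r.
  by apply: (le_trans le2); apply: leeD2r.
by exists K => // k /= Kk k' h Xh; exact: (KP K (leqnn K) h Xh).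
Qed.

(** The decisions of iteration [k.+1] are compared with the model of iteration
    [k], the one they were computed from. The model [cut k s] is also determined
    by the samples of the first [k] iterations, which the sampling argument
    requires. *)
Definition gap_vanishes s := forall n (e : R), stage_of n = s -> 0 < e ->
  \forall k \near \oo, (Q (hist k.+1 s n) <= cut k s (hist k.+1 s n) + e%:E)%E.

(** Whenever the node is sampled late enough, the gap with the model updated at
    that iteration is small because the gaps at its children are, and the gap
    with the previous model differs little from it by uniform convergence. So
    late bad iterations never sample the node; but the hypothesis, which holds
    almost surely, says that infinitely many of them would. *)
Lemma gap_vanishes_step s : (1 <= s < nstages pb)%N ->
  (forall n (i : nat), stage_of n = s ->
    let bad k := ~ (Q (hist k.+1 s n) <=
                    cut k s (hist k.+1 s n) + (i.+1%:R^-1)%:E)%E in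
    (forall N, exists2 k, (N <= k)%N & bad k) ->
    (forall N, exists2 k, (N <= k)%N & bad k /\ sampled_node r k.+1 s w = n)) ->
  gap_vanishes s.+1 -> gap_vanishes s.
Proof.
move=> sT sampling IH n e ns e0.
have [i ie] : exists i : nat, i.+1%:R^-1 < e.
  exists (Num.Def.archi_bound e^-1); rewrite -[ltRHS]invrK ltf_pV2 ?posrE ?invr_gt0 //.
  apply: lt_trans (_ : (Num.Def.archi_bound e^-1)%:R < _); last by rewrite ltr_nat.
  by apply: archi_boundP; rewrite invr_ge0 ltW.
set d : R := i.+1%:R^-1 in ie; have d0 : 0 < d / 2 by rewrite divr_gt0 // invr_gt0.
suff [K KP] : exists K, forall k, (K <= k)%N ->
    (Q (hist k.+1 s n) <= cut k s (hist k.+1 s n) + d%:E)%E.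
  exists K => // k /= /KP /le_trans; apply; apply: leeD2l.
  by rewrite lee_fin ltW.
apply: contrapT => /forallNP noK.
have /(sampling n i ns) : forall N, exists2 k, (N <= k)%N &
    ~ (Q (hist k.+1 s n) <= cut k s (hist k.+1 s n) + d%:E)%E.
  by move=> N; have /existsNP[k /not_implyP[Nk bad]] := noK N; exists k.
apply/existsNP.
have children : \forall k \near \oo, forall j,
    (Q (hist k.+1 s.+1 (child n j)) <=
     cut k s.+1 (hist k.+1 s.+1 (child n j)) + (d / 2)%:E)%E.
  by apply: filter_forall => j; apply: IH => //; rewrite stage_child ns.
have [K1 _ K1P] := children.
have [|K2 _ K2P] := cut_uniform_cauchy (s := s) _ d0; first by lia.
exists (maxn K1 K2) => -[k]; rewrite geq_max => /andP[K1k K2k] [bad nk]; apply: bad.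
have -> : d%:E = (d / 2 + d / 2)%:E by congr EFin; lra.
rewrite EFinD addeA.
have := @sampled_gap k s (d / 2) sT; rewrite /= nk => /(_ (K1P k K1k)).
move=> /le_trans; apply; apply: leeD2r; apply: K2P => //.
by apply: hist_Xprod => //; lia.
Qed.

Lemma gap_vanishes_last : gap_vanishes (nstages pb).
Proof.
move=> n e _ e0; apply: nearW => k; rewrite (dp_last Qdp).
apply: (@le_trans _ _ (0 + e%:E)%E); first by rewrite add0e lee_fin ltW.
apply: leeD2r; apply: le_trans (le_cut _ (leq0n k)).
by rewrite /affine_cut (alg_last alg 0).1 (alg_last alg 0).2 inner0l adde0.
Qed.

End Path.

(** * A conditional Borel-Cantelli lemma *)

Section ConditionalBorelCantelli.
Context {d : measure_display} {Omega : measurableType d} {R : realType}.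
Context (P : probability Omega R).
Context (F : nat -> set (set Omega)) (Bad Hit : nat -> set Omega) (p : R).
Context (F_sigma : forall k, sigma_algebra setT (F k)).
Context (F_mono : forall k, F k `<=` F k.+1).
Context (F_meas : forall k, F k `<=` measurable).
Context (F_Bad : forall k, F k (Bad k)).
Context (F_Hit : forall k, F k.+1 (Hit k)).
Context (p_gt0 : 0 < p).
Context (Hit_indep : forall k A, F k A -> P (A `&` Hit k) = (p%:E * P A)%E).

Let F_setC k A : F k A -> F k (~` A).
Proof. by case: (F_sigma k) => _ FC _ /FC; rewrite setTD. Qed.

Let F_setI k A B : F k A -> F k B -> F k (A `&` B).
Proof.
have sub X : F k X -> X `<=` setT by [].
by have [_ _ _] := (sigma_algebraP sub).1 (F_sigma k); apply.
Qed.

Let F_setU k A B : F k A -> F k B -> F k (A `|` B).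
Proof.
by move=> FA FB; rewrite -[A `|` B]setCK setCU; apply/F_setC/F_setI; exact: F_setC.
Qed.

Context (N : nat).

(** Times are counted from [N]: the argument [k] is an offset. *)
Fixpoint bad_count k w : nat :=
  if k is k'.+1 then (bad_count k' w + `[< Bad (N + k') w >])%N else 0%N.

Definition missed k m : set Omega := [set w | bad_count k w = m /\
  forall i, (i < k)%N -> Bad (N + i) w -> ~ Hit (N + i) w].

(** The event that [N + k] is the [m.+1]-st bad time from [N] on, and that the
    previous ones were missed. For fixed [m], these events are disjoint. *)
Definition bad_after k m : set Omega := missed k m `&` Bad (N + k).

Lemma missed_adapted k m : F (N + k) (missed k m).
Proof.
elim: k m => [|k IH] m.
  case: m => [|m].
    suff -> : missed 0 0 = setT by rewrite -setC0; apply: F_setC; case: (F_sigma (N + 0)).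
    by apply/seteqP; split.
  suff -> : missed 0 m.+1 = set0 by case: (F_sigma (N + 0)).
  by apply/seteqP; split => // w [].
have FB := F_mono (F_Bad (N + k)); have FH := F_Hit (N + k).
rewrite addnS; have -> : missed k.+1 m = (missed k m `&` ~` Bad (N + k)) `|`
    ((if m is m'.+1 then missed k m' else set0) `&` Bad (N + k) `&` ~` Hit (N + k)).
  apply/seteqP; split=> w.
    move=> [/=]; have [bad|nbad] := asboolP (Bad (N + k) w); last first.
      by rewrite addn0 => cm miss; left; split=> //; split=> // i ik; exact/miss/ltnW.
    rewrite addn1; case: m => // m [cm] miss; right.
    split; last exact: miss.
    by split=> //; split=> // i ik; exact/miss/ltnW.
  move=> [[[cm miss] nbad]|[[]]].
    split=> [/=|i]; first by rewrite asboolF ?addn0.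
    by rewrite ltnS leq_eqVlt => /predU1P[->|] //; exact: miss.
  case: m => // m [cm miss] bad nhit; split=> [/=|i].
    by rewrite asboolT // addn1 cm.
  by rewrite ltnS leq_eqVlt => /predU1P[->|] //; exact: miss.
apply: F_setU; last first.
  apply: (F_setI _ (F_setC FH)); apply: (F_setI _ FB).
  case: m => [|m]; first by case: (F_sigma (N + k).+1).
  by apply/F_mono/IH.
by apply: F_setI; [exact/F_mono/IH | exact: F_setC].
Qed.

Lemma bad_after_adapted k m : F (N + k) (bad_after k m).
Proof. by apply: F_setI; [exact: missed_adapted | exact: F_Bad]. Qed.

Lemma bad_count_mono w : {homo bad_count^~ w : k k' / (k <= k')%N}.
Proof. by apply: homo_leq => // [k1 k2 k3|k]; [exact: leq_trans | exact: leq_addr]. Qed.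

Lemma trivIset_bad_after m : trivIset setT (bad_after^~ m).
Proof.
have lt_count k k' w : (k < k')%N -> bad_after k m w -> ~ bad_after k' m w.
  move=> kk' [[cm _] bad] [[cm' _] _].
  have := bad_count_mono w kk'; rewrite /= asboolT // cm cm'.
  by rewrite addn1 ltnn.
move=> k k' _ _ [w [wk wk']].
by case: (ltngtP k k') => // /lt_count; [move/(_ _ wk)|move/(_ _ wk')].
Qed.

(** A bad time with [m.+1] bad times before it, all missed, comes after a bad
    time with [m] such predecessors that is itself missed; the latter miss has
    the conditional probability [1 - p], and [bad_after] selects at most one time
    on each sample path. *)
Lemma bad_after_step m :
  (P (\bigcup_k bad_after k m.+1) <= (1 - p)%:E * P (\bigcup_k bad_after k m))%E.
Proof.
have mG k m' : measurable (bad_after k m') by exact/F_meas/bad_after_adapted.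
have mH k : measurable (Hit k) by exact: F_meas (F_Hit k).
pose miss k := bad_after k m `\` Hit (N + k).
have mmiss k : measurable (miss k) by exact: measurableD.
have sub : \bigcup_k bad_after k m.+1 `<=` \bigcup_k miss k.
  move=> w [k _ [[cm missed_k] _]].
  have [i ik [ci bi]] : exists2 i, (i < k)%N & bad_count i w = m /\ Bad (N + i) w.
    elim: k cm {missed_k} => //= k IH; have [bad|_] := asboolP (Bad (N + k) w).
      by rewrite addn1 => -[cm]; exists k.
    by rewrite addn0 => /IH [i ik]; exists i => //; exact: ltnW.
  exists i => //; split; last exact: missed_k.
  by split=> //; split=> // i' i'i; apply: missed_k; exact: ltn_trans ik.
apply: (@le_trans _ _ (P (\bigcup_k miss k))).
  apply: le_measure => //; rewrite ?inE; exact: bigcup_measurable.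
rewrite measure_bigcup //; last first.
  move=> i j _ _ [w [[wi _] [wj _]]].
  by apply: (trivIset_bad_after (m := m)) => //; exists w.
rewrite measure_bigcup //; last exact: trivIset_bad_after.
rewrite -nneseriesZl //; apply: lee_nneseries => // k _.
rewrite measureD //; last by rewrite (le_lt_trans (probability_le1 P _)) ?ltry.
rewrite [X in (_ - X)%E](Hit_indep (bad_after_adapted k m)).
have Pfin : P (bad_after k m) \is a fin_num by exact: fin_num_measure.
set x := P (bad_after k m) in Pfin *; change (x - p%:E * x <= (1 - p)%:E * x)%E.
by rewrite -(fineK Pfin) -!EFinM -EFinB lee_fin mulrBl mul1r.
Qed.

Lemma p_le1 : p <= 1.
Proof.
have FT : F 0 setT by rewrite -setC0; apply: F_setC; case: (F_sigma 0).
have := Hit_indep FT; rewrite setTI probability_setT mule1 => Pp.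
by rewrite -lee_fin -Pp; apply: probability_le1; exact: F_meas (F_Hit 0).
Qed.

Lemma bad_after_le m : (P (\bigcup_k bad_after k m) <= ((1 - p) ^+ m)%:E)%E.
Proof.
have mG k m' : measurable (bad_after k m') by exact/F_meas/bad_after_adapted.
elim: m => [|m IH].
  by rewrite expr0; apply: probability_le1; exact: bigcup_measurable.
apply: (le_trans (bad_after_step m)).
by rewrite exprS EFinM lee_wpmul2l // lee_fin subr_ge0 p_le1.
Qed.

Lemma bad_after_all w :
  (forall k0, exists2 k, (k0 <= k)%N & Bad k w) ->
  (forall i, (N <= i)%N -> Bad i w -> ~ Hit i w) ->
  forall m, exists k, bad_after k m w.
Proof.
move=> badw nohit.
have next k0 : exists2 k, bad_count k w = bad_count k0 w & Bad (N + k) w.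
  have [k1 k01 bad1] := badw (N + k0)%N.
  have [n] := ubnP (k1 - (N + k0)); elim: n k0 k01 => // n IH k0 k01 kn.
  have [bad0|nbad0] := pselect (Bad (N + k0) w); first by exists k0.
  have k0k1 : (N + k0 != k1)%N by apply: contra_notN nbad0 => /eqP ->.
  have [||k ck bk] := IH k0.+1; [lia | lia |].
  by exists k => //; rewrite ck /= asboolF ?addn0.
have miss k m : bad_count k w = m -> Bad (N + k) w -> bad_after k m w.
  by move=> cm bk; split=> //; split=> // i _; apply: nohit; exact: leq_addr.
elim=> [|m [k [[cm _] bk]]]; first by have [k ck bk] := next 0%N; exists k; exact: miss.
have [k' ck' bk'] := next k.+1; exists k'; apply: miss => //.
by rewrite ck' /= asboolT // cm addn1.
Qed.

Lemma no_hit_negligible : P.-negligible [set w |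
  (forall k0, exists2 k, (k0 <= k)%N & Bad k w) /\
  (forall i, (N <= i)%N -> Bad i w -> ~ Hit i w)].
Proof.
have mG k m' : measurable (bad_after k m') by exact/F_meas/bad_after_adapted.
have mU m : measurable (\bigcup_k bad_after k m) by exact: bigcup_measurable.
have mI : measurable (\bigcap_m \bigcup_k bad_after k m) by exact: bigcap_measurable.
exists (\bigcap_m \bigcup_k bad_after k m); split => //; last first.
  by move=> w [badw nohit] m _; have [k] := bad_after_all badw nohit m; exists k.
apply/eqP; rewrite eq_le measure_ge0 andbT leNgt; apply/negP => P0.
have Pfin : P (\bigcap_m \bigcup_k bad_after k m) \is a fin_num by exact: fin_num_measure.
rewrite -(fineK Pfin) lte_fin in P0.
have q1 : `|1 - p| < 1.
  by rewrite ger0_norm ?subr_ge0 ?p_le1 // ltrBlDl ltrDr.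
have /cvgrPdist_lt /(_ _ P0) [m _ mP] := cvg_expr q1.
have := mP m (leqnn m); rewrite sub0r normrN ger0_norm; last first.
  by rewrite exprn_ge0 // subr_ge0 p_le1.
rewrite ltNge.
move=> /negP; apply; rewrite -lee_fin fineK //.
apply: le_trans (bad_after_le m).
by apply: le_measure; rewrite ?inE // => w; apply.
Qed.

End ConditionalBorelCantelli.

(** If the events [Hit k] are independent of the past [F k] and have the
    probability [p], an infinite adapted set of times cannot avoid them: the
    probability that its first [m] elements from [N] on are all missed is at most
    [(1 - p) ^+ m]. *)
Lemma conditional_borel_cantelli {d : measure_display} {Omega : measurableType d}
    {R : realType} (P : probability Omega R) (F : nat -> set (set Omega))
    (Bad Hit : nat -> set Omega) (p : R) :
  (forall k, sigma_algebra setT (F k)) -> (forall k, F k `<=` F k.+1) ->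
  (forall k, F k `<=` measurable) ->
  (forall k, F k (Bad k)) -> (forall k, F k.+1 (Hit k)) -> 0 < p ->
  (forall k A, F k A -> P (A `&` Hit k) = (p%:E * P A)%E) ->
  {ae P, forall w, (forall N, exists2 k, (N <= k)%N & Bad k w) ->
    forall N, exists2 k, (N <= k)%N & Bad k w /\ Hit k w}.
Proof.
move=> Fs Fm FM FB FH p0 ind.
have := negligible_bigcup (fun N => no_hit_negligible Fs Fm FM FB FH p0 ind N).
apply: negligibleS => w /not_implyP [badw /existsNP [N noN]].
exists N => //; split => // i Ni bi hi; apply: noN.
by exists i.
Qed.

(** * The samples of a run *)

Lemma sigma_algebra_setI {T : Type} (S : set (set T)) A B :
  sigma_algebra setT S -> S A -> S B -> S (A `&` B).
Proof.
move=> sS; have sub X : S X -> X `<=` setT by [].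
by have [_ _ _] := (sigma_algebraP sub).1 sS; apply.
Qed.

(** An event determined by finitely many finitely-valued observables is a
    finite union of their joint level sets; conditioning on one observable at a
    time avoids describing these level sets. *)
Lemma finite_observables {T : Type} {M : nat} (S : set (set T)) (I : eqType)
    (L : seq I) (X : I -> T -> 'I_M) (A : set T) :
  sigma_algebra setT S ->
  (forall q j, q \in L -> S [set w | X q w = j]) ->
  (forall w w', (forall q, q \in L -> X q w = X q w') -> A w -> A w') -> S A.
Proof.
move=> sS; have [S0 SC SU] := sS.
elim: L A => [|q L IH] A SX inv.
  have [[w Aw]|nA] := pselect (A !=set0).
    suff -> : A = setT `\` set0 by exact: SC.
    by rewrite setD0; apply/seteqP; split => // w' _; apply: inv Aw.
  by suff -> : A = set0 by []; apply/seteqP; split => // w Aw; case: nA; exists w.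
pose B j := [set w | exists w', [/\ forall q', q' \in L -> X q' w' = X q' w,
  X q w' = j & A w']].
have SB j : S (B j).
  apply: IH => [q' j' q'L|w w1 ww1 [w' [w'w w'j Aw']]].
    by apply: SX; rewrite in_cons q'L orbT.
  by exists w'; split => // q' q'L; rewrite w'w // ww1.
have -> : A = \bigcup_i (if insub i is Some j then [set w | X q w = j] `&` B j else set0).
  apply/seteqP; split=> [w Aw|w [i _]].
    by exists (X q w) => //; rewrite valK; split => //; exists w.
  case: insub => [j|//] [Xj [w' [w'w w'j Aw']]].
  apply: inv Aw' => q'; rewrite in_cons => /predU1P[->|/w'w //].
  by rewrite w'j -Xj.
apply: SU => i; case: insub => // j; apply: sigma_algebra_setI => //.
by apply: SX; rewrite mem_head.
Qed.

Section Samples.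
Context {R : realType} {disp : measure_display} {Omega : measurableType disp}.
Context {P : probability Omega R} {pb : msp R}.

(** Outcomes carry the product topology, in which singletons are closed. *)
Lemma borel_outcome t (o : xi_type pb t) : <<s @open (xi_type pb t) >> [set o].
Proof.
have [_ SC _] := smallest_sigma_algebra setT (@open (xi_type pb t)).
rewrite -[[set o]]setCK -setTD; apply: SC; apply: sub_sigma_algebra.
apply: closed_openC; apply: compact_closed; last exact: compact_set1.
by do 2?apply: hausdorff_prod; exact: hausdorff_mx.
Qed.

Lemma probability_bigsetU_le (I : finType) (A : I -> set Omega) (i : I) :
  (forall j, measurable (A j)) ->
  (P (\big[setU/set0]_(j | j != i) A j) <= \sum_(j | j != i) P (A j))%E.
Proof.
move=> mA; have [] : measurable (\big[setU/set0]_(j | j != i) A j) /\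
  (P (\big[setU/set0]_(j | j != i) A j) <= \sum_(j | j != i) P (A j))%E; last by [].
apply: (big_rec2 (fun B b => measurable B /\ (P B <= b)%E)) => [|j B b _ [mB PB]].
  by rewrite measure0.
split; first exact: measurableU.
by apply: (le_trans (measureU2 P (mA j) mB)); exact: leeD2l.
Qed.

(** Were two outcomes equal, the others would carry a total mass smaller than
    one. *)
Lemma outcome_inj (xi : forall t, Omega -> xi_type pb t) t :
  random_element (xi t) -> {ae P, forall w, exists j, xi t w = outcome pb t j} ->
  (forall j, P (xi t @^-1` [set outcome pb t j]) = (Phi pb t j)%:E) ->
  (forall j, 0 < Phi pb t j) -> \sum_j Phi pb t j = 1 ->
  injective (outcome pb t).
Proof.
move=> mxi supp PhiE Phi0 Phi1 i j eq_ij; apply/eqP/negPn/negP => neq_ij.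
pose A k := xi t @^-1` [set outcome pb t k].
have mA k : measurable (A k) by apply: mxi; exact: borel_outcome.
have := probability_bigsetU_le i mA.
have -> : (\sum_(k | k != i) P (A k) = (1 - Phi pb t i)%:E)%E.
  apply: (@etrans _ _ (\sum_(k | k != i) (Phi pb t k)%:E)%E).
    by apply: eq_bigr => k _; exact: PhiE.
  rewrite sumEFin; congr EFin.
  by move: Phi1; rewrite (bigD1 i) //= => <-; rewrite addrAC subrr add0r.
have mU : measurable (\big[setU/set0]_(k | k != i) A k).
  by elim/big_ind: _ => // B C; exact: measurableU.
have PC0 : P (~` (\big[setU/set0]_(k | k != i) A k)) = 0.
  apply: measure_negligible; first exact: measurableC.
  apply: negligibleS supp => w nU [k wk]; apply: nU.
  have [k' k'i wk'] : exists2 k', k' != i & A k' w.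
    have [ki|ki] := eqVneq k i; last by exists k.
    by exists j; [rewrite eq_sym | rewrite /A /= wk ki eq_ij].
  by rewrite (bigD1 k') //=; left.
have : P (\big[setU/set0]_(k | k != i) A k) = 1%E.
  rewrite -[\big[_/_]_(_ | _) _]setCK probability_setC; last exact: measurableC.
  by rewrite PC0 sube0.
by move=> ->; rewrite lee_fin lerBrDl gerDr leNgt Phi0.
Qed.

Context (r : run pb Omega) (outcomeI : forall t, (2 <= t <= nstages pb)%N ->
  injective (outcome pb t)).

Lemma same_samples_sym k w w' : same_samples r k w w' -> same_samples r k w' w.
Proof. by move=> ww' l t lk tT; rewrite ww'. Qed.

Lemma same_samplesS k k' w w' : (k <= k')%N -> same_samples r k' w w' ->
  same_samples r k w w'.
Proof.
by move=> kk' ww' l t /andP[l1 lk] tT; apply: ww' => //; rewrite l1 (leq_trans lk).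
Qed.

Lemma same_sample k w w' l t : same_samples r k w w' -> (1 <= l <= k)%N ->
  (2 <= t <= nstages pb)%N -> sample r l t w = sample r l t w'.
Proof. by move=> ww' lk tT; apply: (outcomeI tT); exact: ww'. Qed.

Lemma same_sampled_node k w w' l t : same_samples r k w w' -> (1 <= l <= k)%N ->
  (t <= nstages pb)%N -> sampled_node r l t w = sampled_node r l t w'.
Proof.
move=> ww' lk; elim: t => //= -[//|t] IH tT.
by rewrite IH 1?ltnW // (same_sample ww').
Qed.

(** The information available when iteration [k.+1] starts. It is encoded as
    invariance, so that whatever the algorithm computes from the samples is
    adapted by definition; the finiteness of the set of outcomes gives
    measurability. *)
Definition sample_events k : set (set Omega) :=
  [set A | forall w w', same_samples r k w w' -> A w -> A w'].

Lemma sigma_algebra_sample_events k : sigma_algebra setT (sample_events k).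
Proof.
split=> [//|A FA|A FA] w w' ww'.
  by move=> [_ nAw]; split => // /(FA _ _ (same_samples_sym ww')).
by move=> [i _ Aiw]; exists i => //; exact: FA ww' Aiw.
Qed.

Lemma sample_eventsS k : sample_events k `<=` sample_events k.+1.
Proof. by move=> A FA w w' /(same_samplesS (leqnSn k)); exact: FA. Qed.

Lemma sample_events_sub k (S : set (set Omega)) : sigma_algebra setT S ->
  (forall l t j, (1 <= l <= k)%N -> (2 <= t <= nstages pb)%N ->
    S [set w | sample r l t w = j]) -> sample_events k `<=` S.
Proof.
move=> sS SX A FA.
pose L := [seq (l, t) | l <- iota 1 k, t <- iota 2 (nstages pb).-1].
have inL l t : ((l, t) \in L) = (1 <= l <= k)%N && (2 <= t <= nstages pb)%N.
  apply/allpairsP/idP => [[[l' t'] [/= + + [-> ->]]]|lt].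
    by rewrite !mem_iota; lia.
  by exists (l, t); rewrite !mem_iota; split => //=; lia.
apply: (@finite_observables _ _ S _ L (fun q => sample r q.1 q.2)) => //.
  by move=> [l t] j; rewrite inL => /andP[lk tT]; exact: SX.
move=> w w' ww'; apply: FA => l t lk tT; rewrite /sampled_xi.
by have := ww' (l, t); rewrite inL lk tT /= => ->.
Qed.

Lemma sample_eqE l t j : (2 <= t <= nstages pb)%N ->
  [set w | sample r l t w = j] = sampled_xi r l t @^-1` [set outcome pb t j].
Proof.
move=> tT; apply/seteqP; split=> w /=; rewrite /sampled_xi; first by move=> ->.
exact: outcomeI.
Qed.

Lemma sigma_of_sample l t j : (2 <= t <= nstages pb)%N ->
  sigma_of (sampled_xi r l t) [set w | sample r l t w = j].
Proof.
move=> tT; exists [set outcome pb t j]; first exact: borel_outcome.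
by rewrite setTI sample_eqE.
Qed.

Context (sample_meas : forall k t, (1 <= k)%N -> (2 <= t <= nstages pb)%N ->
  random_element (sampled_xi r k t)).
Context (sample_Phi : forall k t j, (1 <= k)%N -> (2 <= t <= nstages pb)%N ->
  P (sampled_xi r k t @^-1` [set outcome pb t j]) = (Phi pb t j)%:E).
Context (sample_indep : forall k t, (1 <= k)%N -> (2 <= t <= nstages pb)%N ->
  independent_of P (sampled_xi r k t) (sigma_past r k t)).

Lemma sample_events_measurable k : sample_events k `<=` measurable.
Proof.
apply: sample_events_sub; first exact: sigma_algebra_measurable.
move=> l t j /andP[l1 _] tT; rewrite sample_eqE //.
by apply: sample_meas => //; exact: borel_outcome.
Qed.

Lemma sigma_algebra_past k t : sigma_algebra setT (sigma_past r k t).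
Proof. exact: smallest_sigma_algebra. Qed.

Lemma sample_events_past k t : sample_events k `<=` sigma_past r k.+1 t.
Proof.
apply: sample_events_sub; first exact: sigma_algebra_past.
move=> l t' j /andP[l1 lk] t'T; apply: sub_sigma_algebra; exists (l, t').
  by left; rewrite /= l1 ltnS.
exact: sigma_of_sample.
Qed.

Definition node_sampled k (l : seq 'I_(nscen pb)) : set Omega :=
  [set w | sampled_node r k.+1 (size l).+1 w = Node l].

Lemma node_sampled_cons k j l : node_sampled k (j :: l) =
  [set w | sample r k.+1 (size l).+2 w = j] `&` node_sampled k l.
Proof.
have cons w : sampled_node r k.+1 (size (j :: l)).+1 w =
  child (sampled_node r k.+1 (size l).+1 w) (sample r k.+1 (size l).+2 w) by [].
apply/seteqP; split=> w; rewrite /node_sampled /setI /mkset cons.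
  by case: (sampled_node r k.+1 (size l).+1 w) => [|l'] //= [-> ->].
by move=> [<- ->].
Qed.

Lemma node_sampled_nil k : node_sampled k [::] = setT.
Proof. by apply/seteqP; split. Qed.

Lemma node_sampled_past k l t : ((size l).+1 < t)%N -> (t <= (nstages pb).+1)%N ->
  sigma_past r k.+1 t (node_sampled k l).
Proof.
have sP := sigma_algebra_past k.+1 t.
elim: l => [|j l IH] lt tT.
  by rewrite node_sampled_nil -[setT]setD0; case: sP => S0 SC _; exact: SC.
rewrite node_sampled_cons; apply: (sigma_algebra_setI sP); last exact: IH (ltnW lt) tT.
apply: sub_sigma_algebra; exists (k.+1, (size l).+2); first by right.
by apply: sigma_of_sample; move: lt => /=; lia.
Qed.

(** The most recent outcome comes first in [l], and the node [Node l] is at the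
    stage [(size l).+1]. *)
Fixpoint node_prob (l : seq 'I_(nscen pb)) : R :=
  if l is j :: l' then Phi pb (size l).+1 j * node_prob l' else 1.

Lemma node_prob_gt0 l : ((size l).+1 <= nstages pb)%N ->
  (forall t j, (2 <= t <= nstages pb)%N -> 0 < Phi pb t j) -> 0 < node_prob l.
Proof.
move=> + Phi0; elim: l => [|j l IH] //= lT; rewrite mulr_gt0 //; last by apply: IH; lia.
exact: Phi0.
Qed.

(** The stages of an iteration are sampled one after the other, each one
    independently of everything sampled before. *)
Lemma node_sampled_indep k l A : ((size l).+1 <= nstages pb)%N -> sample_events k A ->
  P (A `&` node_sampled k l) = ((node_prob l)%:E * P A)%E.
Proof.
move=> lT FA; elim: l lT => [|j l IH] lT; first by rewrite node_sampled_nil setIT mul1e.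
have tT : (2 <= (size l).+2 <= nstages pb)%N by [].
have past : sigma_past r k.+1 (size l).+2 (A `&` node_sampled k l).
  apply: (sigma_algebra_setI (sigma_algebra_past _ _)).
    exact: (@sample_events_past k _ A FA).
  by apply: node_sampled_past; rewrite //; exact: ltnW.
rewrite node_sampled_cons setICA.
rewrite (sample_indep (ltn0Sn k) tT (sigma_of_sample _ j tT) past).
rewrite sample_eqE // sample_Phi // IH; last by rewrite ltnW.
by rewrite muleA -EFinM.
Qed.

Context (r_alg : forall w, run_spec r w) (r_nonanticipative : nonanticipative r).

Lemma same_dec k m w w' : (1 <= stage_of m <= nstages pb)%N ->
  same_samples r k w w' -> dec r k.+1 m w = dec r k.+1 m w'.
Proof. exact: r_nonanticipative.1. Qed.

Lemma same_run_hist k s n w w' : (s <= nstages pb)%N -> stage_of n = s ->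
  same_samples r k w w' -> run_hist r k.+1 s n w = run_hist r k.+1 s n w'.
Proof.
move=> sT ns ww'; apply/matrixP => i a; rewrite !mxE (same_dec _ ww') //.
rewrite stage_iter_parent ns subKn; last exact: ltn_ord.
by rewrite (leq_trans _ sT) // ltn_ord.
Qed.

Lemma same_cut_model k s w w' (h : 'M[R]_(dimx pb, s)) : (1 <= s < nstages pb)%N ->
  same_samples r k w w' -> cut_model r k w h = cut_model r k w' h.
Proof.
move=> sT ww'; apply: eq_bigr => -[[|l] lk] _ /=; rewrite /affine_cut.
  by rewrite (alg_init (r_alg w) sT).1 (alg_init (r_alg w') sT).1.
have wwl : same_samples r l.+1 w w' by apply: same_samplesS ww'; rewrite -ltnS.
have sT' : (s <= nstages pb)%N by lia.
have [-> ->] := r_nonanticipative.2 l s w w' sT wwl.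
rewrite (same_sampled_node wwl) ?ltnS ?leqnn //.
rewrite (@same_run_hist l s _ w w') //; first exact: stage_sampled_node.
exact: same_samplesS wwl.
Qed.

End Samples.

(** * Convergence *)

Lemma cvge_squeeze {R : realType} (u : nat -> \bar R) (a : R) :
  (forall e : R, 0 < e -> \forall k \near \oo,
     ((a - e)%:E <= u k)%E /\ (u k <= (a + e)%:E)%E) ->
  u @ \oo --> a%:E.
Proof.
move=> ua; apply/fine_cvgP.
have u_fin e k : ((a - e)%:E <= u k)%E /\ (u k <= (a + e)%:E)%E -> u k \is a fin_num.
  by case: (u k) => [x||] [].
split; first by apply: filterS (ua 1 ltr01) => k; exact: u_fin.
apply/cvgrPdist_le => e e0; apply: filterS (ua e e0) => k uk.
have ukf := u_fin _ _ uk.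
by rewrite /= ler_distlC -!lee_fin fineK //; apply/andP.
Qed.

(** There are countably many nodes and tolerances [1 / i.+1], so that one
    negligible set can be discarded for all of them before the backward induction
    on the stages takes place. *)
Lemma gap_ae_vanishes {R : realType} {disp : measure_display}
    {Omega : measurableType disp} {P : probability Omega R} {pb : msp R} {eps : R}
    {Q : forall s, 'M[R]_(dimx pb, s) -> \bar R} {r : run pb Omega} :
  (0 < nscen pb)%N ->
  wellposed pb eps -> dp_solution Q ->
  (forall t, (2 <= t <= nstages pb)%N -> injective (outcome pb t)) ->
  (forall t j, (2 <= t <= nstages pb)%N -> 0 < Phi pb t j) ->
  (forall w, run_spec r w) -> nonanticipative r ->
  (forall k t, (1 <= k)%N -> (2 <= t <= nstages pb)%N ->
     random_element (sampled_xi r k t)) ->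
  (forall k t j, (1 <= k)%N -> (2 <= t <= nstages pb)%N ->
     P (sampled_xi r k t @^-1` [set outcome pb t j]) = (Phi pb t j)%:E) ->
  (forall k t, (1 <= k)%N -> (2 <= t <= nstages pb)%N ->
     independent_of P (sampled_xi r k t) (sigma_past r k t)) ->
  {ae P, forall w s, (1 <= s <= nstages pb)%N ->
     gap_vanishes (Q := Q) (r := r) (w := w) s}.
Proof.
move=> hM wp Qdp outcomeI Phi0 alg nonant smeas sPhi sindep.
pose Bad (l : seq 'I_(nscen pb)) (i : nat) k : set Omega := [set w |
  ~ (Q _ (run_hist r k.+1 (size l).+1 (Node l) w) <=
     cut_model r k w (run_hist r k.+1 (size l).+1 (Node l) w) + (i.+1%:R^-1)%:E)%E].
have sampling (l : seq 'I_(nscen pb)) (i : nat) : ((size l).+1 < nstages pb)%N ->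
  {ae P, forall w, (forall N, exists2 k, (N <= k)%N & Bad l i k w) ->
    forall N, exists2 k, (N <= k)%N & Bad l i k w /\ node_sampled r k l w}.
  move=> lT; have lT' : ((size l).+1 <= nstages pb)%N by exact: ltnW.
  apply: (@conditional_borel_cantelli _ _ _ P (sample_events r) (Bad l i)
    (fun k => node_sampled r k l) (node_prob l)).
  - exact: sigma_algebra_sample_events.
  - exact: sample_eventsS.
  - exact: (sample_events_measurable outcomeI smeas).
  - move=> k w w' ww'; rewrite /Bad /mkset (same_run_hist nonant lT' _ ww') //.
    by rewrite (same_cut_model outcomeI alg nonant _ _ ww').
  - move=> k w w' ww'; rewrite /node_sampled /mkset.
    by rewrite (same_sampled_node outcomeI ww') ?ltnS ?leqnn.
  - exact: node_prob_gt0.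
  - move=> k A FA; exact: (node_sampled_indep outcomeI sPhi sindep).
have [seq_of seq_ofK] : exists seq_of : nat -> seq 'I_(nscen pb), forall l,
    exists q, seq_of q = l.
  exists (fun q => odflt [::] (unpickle q)) => l; exists (pickle l).
  by rewrite pickleK.
have {}sampling : {ae P, forall w (q i : nat), ((size (seq_of q)).+1 < nstages pb)%N ->
    (forall N, exists2 k, (N <= k)%N & Bad (seq_of q) i k w) ->
    forall N, exists2 k, (N <= k)%N &
      Bad (seq_of q) i k w /\ node_sampled r k (seq_of q) w}.
  apply: ae_foralln => q; apply: ae_foralln => i.
  have [lT|lT] := boolP ((size (seq_of q)).+1 < nstages pb)%N.
    by apply: filterS (sampling (seq_of q) i lT) => w + _.
  by apply: (aeW P).
apply: filterS sampling => w sampling; apply: backward_ind.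
  exact: (gap_vanishes_last Qdp (alg w)).
move=> s sT; apply: (gap_vanishes_step wp Qdp (alg w) hM sT) => -[|l] i ns /=.
  by move: sT; rewrite -ns.
case: (seq_ofK l) ns => q <- ns; case: _ / ns sT => sT bad.
by have /andP[_ lT] := sT; exact: (sampling q i lT bad).
Qed.

Theorem theorem4p1 (R : realType) (disp : measure_display)
  (Omega : measurableType disp) (P : probability Omega R)
  (pb : msp R)
  (hT : (0 < nstages pb)%N) (hM : (0 < nscen pb)%N)
  (f_codomain : forall t (h : 'M[R]_(dimx pb, t)) psi,
     (1 <= t <= nstages pb)%N -> cost pb h psi != -oo%E)
  (* the process (xi_t) *)
  (xi : forall t, Omega -> xi_type pb t) (xi_1 : xi_type pb 1)
  (xi_meas : forall t, (1 <= t <= nstages pb)%N -> random_element (xi t))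
  (xi_indep : interstage_independent P xi)
  (xi1_deterministic : forall w, xi 1%N w = xi_1)
  (xi1_outcome : forall j, outcome pb 1 j = xi_1)
  (xi_support : forall t, (2 <= t <= nstages pb)%N ->
     {ae P, forall w, exists j, xi t w = outcome pb t j})
  (xi_Phi : forall t j, (2 <= t <= nstages pb)%N ->
     P (xi t @^-1` [set outcome pb t j]) = (Phi pb t j)%:E)
  (Phi_pos : forall t j, (2 <= t <= nstages pb)%N -> 0 < Phi pb t j)
  (Phi_sum : forall t, (2 <= t <= nstages pb)%N -> \sum_j Phi pb t j = 1)
  (* the risk measures *)
  (rho : nat -> (Omega -> \bar R) -> \bar R)
  (rho_coherent : forall t, (2 <= t <= nstages pb)%N ->
     coherent_law_invariant P (sigma_of (xi t)) (rho t))
  (ambig_convex : forall t, (2 <= t <= nstages pb)%N ->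
     convex_set (ambig pb t))
  (ambig_sub : forall t p, (2 <= t <= nstages pb)%N -> ambig pb t p ->
     (forall j, 0 <= p j ord0) /\ \sum_j p j ord0 * Phi pb t j = 1)
  (rho_dual : forall t, (2 <= t <= nstages pb)%N ->
     dual_representation xi rho t)
  (* (1) *)
  (H1 : forall t, (1 <= t <= nstages pb)%N ->
     [/\ Xset pb t !=set0, convex_set (Xset pb t) & compact (Xset pb t)])
  (* (2) *)
  (H2 : forall t, (1 <= t <= nstages pb)%N ->
     (forall h : 'M[R]_(dimx pb, t),
        @measurable_fun _ _
          (g_sigma_algebraType (@open 'cV[R]_(dimPsi pb t))) (\bar R) setT
          (cost pb h)) /\
     (forall j,
        let F := fun h : 'M[R]_(dimx pb, t) =>
          cost pb h (noise_Psi (outcome pb t j)) in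
        [/\ eproper F, econvex F & lower_semicontinuous F]))
  (* (3) *)
  (H3 : forall t j i, (1 <= t <= nstages pb)%N ->
     let G := fun h : 'M[R]_(dimx pb, t) =>
       (constr pb (x0 pb) h (noise_Psi (outcome pb t j)) i ord0)%:E in
     econvex G /\ lower_semicontinuous G)
  (* (4), at stage s.+1 *)
  (H4 : exists2 eps : R, 0 < eps & forall s j, (s < nstages pb)%N ->
     [set snoc h x | h in fatten eps (Xprod pb s) & x in Xset pb s.+1]
       `<=` edom (fun h => cost pb h (noise_Psi (outcome pb s.+1 j))) /\
     (forall h, fatten eps (Xprod pb s) h ->
        feasible h (outcome pb s.+1 j) !=set0))
  (* (5), at stage s.+1 *)
  (H5 : forall s j, (1 <= s < nstages pb)%N ->
     exists (h : 'M[R]_(dimx pb, s)) (x : 'cV[R]_(dimx pb)),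
       [/\ Xprod pb s h, relint (Xset pb s.+1) x,
           relint (glevel (noise_Psi (outcome pb s.+1 j))) (snoc h x) &
           feasible h (outcome pb s.+1 j) x])
  (* Algorithm 1 *)
  (r : run pb Omega)
  (r_alg : forall w, run_spec r w)
  (r_nonanticipative : nonanticipative r)
  (sample_meas : forall k t, (1 <= k)%N -> (2 <= t <= nstages pb)%N ->
     random_element (sampled_xi r k t))
  (sample_Phi : forall k t j, (1 <= k)%N -> (2 <= t <= nstages pb)%N ->
     P (sampled_xi r k t @^-1` [set outcome pb t j]) = (Phi pb t j)%:E)
  (sample_indep : forall k t, (1 <= k)%N -> (2 <= t <= nstages pb)%N ->
     independent_of P (sampled_xi r k t) (sigma_past r k t)) :
  (* (i), for the recourse function of stage s.+1 *)
  {ae P, forall w, forall s, (1 <= s <= nstages pb)%N ->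
     forall n : node (nscen pb), stage_of n = s ->
     (fun k => (recourse xi rho (run_hist r k s n w)
                - cut_model r k w (run_hist r k s n w))%E) @ \oo --> 0%E} /\
  (* (ii) *)
  {ae P, forall w,
     ((fun k => stage_value (cut_model r k (s := 1) w)
                  (0 : 'M[R]_(dimx pb, 0)) xi_1) @ \oo -->
      stage_value (recourse xi rho (s := 1)) (0 : 'M[R]_(dimx pb, 0)) xi_1) /\
     (forall x : 'cV[R]_(dimx pb),
        cluster ((fun k => dec r k (Node [::]) w) @ \oo) x ->
        stage_opt (recourse xi rho (s := 1)) (0 : 'M[R]_(dimx pb, 0)) xi_1 x)}.
Proof.
have [eps eps0 H4eps] := H4.
have wp : wellposed pb eps.
  split=> //.
  - move=> t p tT pA; have [p0 p1] := ambig_sub t p tT pA; split=> // j.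
    by rewrite mulr_ge0 // ltW // Phi_pos.
  - by move=> t /H1 [].
  - by move=> t j tT; have [_ /(_ j) []] := H2 t tT.
  - by move=> t j i tT; have [] := H3 t j i tT.
  - move=> s j h x sT hF Xx; have [sub _] := H4eps s j sT.
    by apply: (sub (snoc h x)); exists h => //; exists x.
  - by move=> s j h sT hF; have [_] := H4eps s j sT; apply.
pose Q s := @recourse R pb Omega xi rho s.
have Qdp : dp_solution Q.
  split=> [h|s h sT]; rewrite /Q /recourse; first by rewrite subnn.
  have -> : (nstages pb - s = (nstages pb - s.+1).+1)%N by lia.
  rewrite /=; have s1T : (2 <= s.+1 <= nstages pb)%N by lia.
  exact: (rho_dual s.+1 s1T (fun v => stage_value (@Q s.+1) h v)).
have outcomeI t : (2 <= t <= nstages pb)%N -> injective (outcome pb t).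
  move=> tT; apply: (@outcome_inj _ _ _ P _ xi) => //.
  - by apply: xi_meas; lia.
  - exact: xi_support.
  - by move=> j; exact: xi_Phi.
  - by move=> j; exact: Phi_pos.
  - exact: Phi_sum.
have gap := gap_ae_vanishes hM wp Qdp outcomeI Phi_pos r_alg
  r_nonanticipative sample_meas sample_Phi sample_indep.
split.
  apply: filterS gap => w gap s sT n ns; apply: cvge_squeeze => e e0.
  have [K1 _ K1P] := gap s sT n e ns e0.
  have [K2 _ K2P] := cut_fin wp (r_alg w) sT.
  exists (maxn K1 K2).+1 => // -[//|k]; rewrite /= ltnS geq_max => /andP[K1k K2k].
  set h := run_hist _ _ _ _ _.
  have Xh : Xprod pb s h by apply: (hist_Xprod (r_alg w) hM) => //; lia.
  have cut_kfin : cut_model r k.+1 w h \is a fin_num by apply: K2P; exact: leqW.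
  have le1 := cut_le_dp wp Qdp (r_alg w) k.+1 h sT.
  have le2 : (Q s h <= cut_model r k w h + e%:E)%E := K1P k K1k.
  have le3 : (cut_model r k w h <= cut_model r k.+1 w h)%E by exact: cut_mono.
  have Qy : (Q s h < +oo)%E by apply: (dp_lty wp Qdp) => //; exact: fatten_sub.
  have Qfin : Q s h \is a fin_num.
    rewrite fin_numElt Qy andbT; apply: lt_le_trans le1.
    by rewrite ltNye; move: cut_kfin; rewrite fin_numE => /andP[].
  have {le2}le2 : (Q s h <= cut_model r k.+1 w h + e%:E)%E.
    by apply: (le_trans le2); exact: leeD2r.
  rewrite -[recourse _ _ _]/(Q s h) -(fineK Qfin) -(fineK cut_kfin).
  move: le1 le2; rewrite -(fineK Qfin) -(fineK cut_kfin) -EFinB -!EFinD !lee_fin.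
  by move=> le1 le2; split; lra.
apply: filterS gap => w gap.
have j : 'I_(nscen pb) by exact: Ordinal hM.
have xi1E := xi1_outcome j; rewrite -xi1E.
pose x k := dec r k.+1 (Node [::]) w.
pose V := stage_value (@Q 1%N) (0 : 'M[R]_(dimx pb, 0)) (outcome pb 1 j).
pose Vk k := stage_value (cut_model r k (s := 1) w) (0 : 'M[R]_(dimx pb, 0)) (outcome pb 1 j).
rewrite -[stage_value (recourse xi rho (s := 1)) _ _]/V.
have T1 : (1 <= 1 <= nstages pb)%N by [].
have [Q1Ny Q1lsc] := dp_lsc wp Qdp (ambig_neq0 (r_alg w)) T1.
have X0 : fatten eps (Xprod pb 0) 0 by apply: fatten_sub => -[].
have V_fin : V \is a fin_num.
  rewrite fin_numElt; apply/andP; split.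
    by rewrite ltNye; exact: (stage_value_neqNy wp).
  by apply: (stage_value_lty wp) => // h; exact: (dp_lty wp Qdp).
have hist1 k : run_hist r k.+1 1 (Node [::]) w = snoc 0 (x k).
  rewrite -[Node [::]]/(child Root j) run_hist_child; congr snoc.
  by rewrite [LHS]thinmx0.
have xopt k : feasible 0 (outcome pb 1 j) (x k) /\
    stage_obj (cut_model r k w) 0 (outcome pb 1 j) (x k) = Vk k.
  have := alg_decision (r_alg w) k j hT (erefl : stage_of Root = 0%N).
  by rewrite [run_hist _ _ _ _ _]thinmx0.
have VkV k : (Vk k <= V)%E.
  by apply: stage_value_mono => h; exact: (cut_le_dp wp Qdp (r_alg w)).
have objV (e : R) : 0 < e -> \forall k \near \oo,
    (stage_obj (@Q 1%N) 0 (outcome pb 1 j) (x k) <= Vk k + e%:E)%E.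
  move=> e0; apply: filterS (gap 1%N T1 (Node [::]) e erefl e0) => k.
  by rewrite hist1 -(xopt k).2 /stage_obj -addeA; exact: leeD2l.
split.
  rewrite -(fineK V_fin); apply: cvge_squeeze => e e0.
  apply: filterS (objV e e0) => k obj_le.
  have := le_trans (stage_value_le (@Q 1%N) (xopt k).1) obj_le.
  rewrite -/V => VVk; split.
    by rewrite EFinB fineK // leeBlDr.
  apply: (le_trans (VkV k)); rewrite EFinD fineK // leeDl // lee_fin ltW //.
move=> y cy.
have near_y (B : set 'cV[R]_(dimx pb)) K : nbhs y B -> exists2 k, (K <= k)%N & B (x k).
  move=> yB; have [|z [[k Kk <-] Bz]] := cy [set x k | k in [set k | (K <= k)%N]] B _ yB.
    exists K.+1 => // -[//|k] /= Kk; exists k => //.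
  by exists k.
have Xy : Xset pb 1 y.
  have cX : closed (Xset pb 1).
    by apply: compact_closed; [exact: hausdorff_mx | exact: (wp_compact wp)].
  apply: cX => B /(near_y _ 0%N) [k _ Bk]; exists (x k); split=> //.
  by have [[]] := xopt k.
(* Nearness of pairs (decision, history) is restricted to the single history
   that exists at stage 0. *)
have slice (C : set ('cV[R]_(dimx pb) * 'M[R]_(dimx pb, 0))) :
    nbhs (y, 0 : 'M[R]_(dimx pb, 0)) C -> nbhs y [set z | C (z, 0)].
  move=> [[A B] [/= yA B0] AB]; apply: filterS yA => z Az; apply: AB.
  by split=> //; exact: nbhs_singleton.
have fy : feasible 0 (outcome pb 1 j) y.
  apply: contrapT => nfy; have := slice _ (near_infeasible wp hT Xy nfy).
  by move=> /(near_y _ 0%N) [k _ /=]; apply; exact: (xopt k).1.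
split=> //; apply/eqP; rewrite -/V eq_le stage_value_le // andbT leNgt.
apply/negP => Vy.
have [a Va ay] : exists2 a : R, fine V < a &
    (a%:E < stage_obj (@Q 1%N) 0 (outcome pb 1 j) y)%E.
  move: Vy; rewrite -[V in (V < _)%E](fineK V_fin).
  case: (stage_obj _ _ _ _) => [b||] //; rewrite ?lte_fin => Vb.
    by exists ((fine V + b) / 2); rewrite ?lte_fin; lra.
  by exists (fine V + 1); rewrite ?ltry ?ltrDl.
have aV : 0 < a - fine V by rewrite subr_gt0.
have [K _ KP] := objV _ aV.
have := slice _ (near_stage_obj wp hT Q1Ny Q1lsc Xy (fun _ => ay)).
move=> /(near_y _ K) [k Kk /= /(_ (xopt k).1)]; apply/negP; rewrite -leNgt.
apply: (le_trans (KP k Kk)); apply: (@le_trans _ _ (V + (a - fine V)%:E)%E).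
  exact: leeD2r.
by rewrite -(fineK V_fin) -EFinD lee_fin /= addrC subrK.
Qed.
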